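(* Let $N,M\ge 1$ be integers. Fix $q,x_i,y_j,z_k\in\mathbb{C}$ such that for some constant $\epsilon<1$, independent of $i,j,k$, one has for all $1\le i\le N$, $1\le j\le M$, $k\ge 1$: $$\left|\frac{(1-q^3y_jz_k)}{(1-qy_jz_k)}\cdot\frac{(x_i-z_k)}{(x_i-q^2z_k)}\right|<\epsilon<1,\qquad \left|\frac{(1-q^2y_jz_k)(1-q^3y_jz_k)}{(1-y_jz_k)(1-qy_jz_k)}\cdot\frac{(x_i-z_k)(x_i-qz_k)}{(x_i-q^2z_k)(x_i-q^3z_k)}\right|<\epsilon<1 .$$ Then $$\sum_{S}(-1)^{|S|/2}q^{4MN-|S|^2}c_S(q)\,H_S(x_1,\dots,x_N;\bm{z})\,H_S(y_1,\dots,y_M;q^{-3}\bm{z}^{-1})=\prod_{i=1}^{N}\prod_{j=1}^{M}\frac{(1-q^2x_iy_j)(1-q^3x_iy_j)}{(1-x_iy_j)(1-qx_iy_j)},$$ where the sum is over all 2-strings $S$ (of arbitrary weight, even or odd), and $q^{-3}\bm{z}^{-1}=(q^{-3}z_1^{-1},q^{-3}z_2^{-1},\dots)$.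
   Context: **Weights.** For $i,j,k,\ell\in\{0,1,2\}$ the Izergin--Korepin vertex weight $W_{y/x}(i,j;k,\ell)$ ($i$ = bottom incoming state, $j$ = left incoming state, $k$ = top outgoing state, $\ell$ = right outgoing state; $x$ = parameter of the horizontal line, $y$ = parameter of the vertical line) is a rational function depending on $x,y$ only through $y/x$; with $D=(x-q^2y)(x-q^3y)$, $W(0,0;0,0)=W(2,2;2,2)=1$; $W(1,0;1,0)=W(2,1;2,1)=\frac{q^2(x-y)}{x-q^2y}$; $W(1,0;0,1)=W(2,1;1,2)=\frac{(1-q^2)x}{x-q^2y}$; $W(0,1;1,0)=W(1,2;2,1)=\frac{(1-q^2)y}{x-q^2y}$; $W(0,1;0,1)=W(1,2;1,2)=\frac{x-y}{x-q^2y}$; $W(2,0;2,0)=\frac{q^4(x-y)(x-qy)}{D}$; $W(2,0;1,1)=-\frac{q(1-q)^2(1+q)x(x-y)}{D}$; $W(2,0;0,2)=\frac{(1-q^2)x(x+qx-qy-q^3y)}{D}$; $W(1,1;2,0)=-\frac{q^4(1+q)(x-y)y}{D}$; $W(1,1;1,1)=\frac{-qx^2+(1+q)(1-q^2+q^4)xy-q^4y^2}{D}$; $W(1,1;0,2)=\frac{(1+q)x(x-y)}{D}$; $W(0,2;2,0)=\frac{(1-q^2)(x+q^2x-q^2y-q^3y)y}{D}$; $W(0,2;1,1)=\frac{q(1-q)^2(1+q)(x-y)y}{D}$; $W(0,2;0,2)=\frac{(x-y)(x-qy)}{D}$; and $W=0$ in all other cases. Parameters are taken away from the poles of the rational functions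 involved. **2-strings.** A 2-string is an infinite vector $S=(S_1,S_2,\dots)$ with $S_i\in\{0,1,2\}$ and only finitely many nonzero entries; $|S|=\sum_i S_i$. $\bm{z}=(z_1,z_2,\dots)$. **$F_S^I$.** For $I=(I_1,\dots,I_N)\in\{0,1,2\}^N$ with $|I|=\sum_r I_r=|S|$, choose $L$ with $S_c=0$ for $c>L$ and put $$F_S^I(x_1,\dots,x_N;\bm{z})=\sum\prod_{r=1}^{N}\prod_{c=1}^{L}W_{z_c/x_r}(v_{r-1,c},h_{r,c-1};v_{r,c},h_{r,c}),$$ summed over all $h_{r,c}\in\{0,1,2\}$ ($1\le r\le N$, $0\le c\le L$) and $v_{r,c}\in\{0,1,2\}$ ($0\le r\le N$, $1\le c\le L$) with $h_{r,0}=I_r$, $h_{r,L}=0$, $v_{0,c}=0$, $v_{N,c}=S_c$ (independent of $L$). **$H_S$.** For any 2-string $S$, $$H_S(x_1,\dots,x_N;\bm{z})=\sum_{I\in\{0,1,2\}^N:\,|I|=|S|}(-1)^{\mathfrak{c}_1(I)/2}(1-q^{-1})^{\mathfrak{c}_1(I)}q^{-\mathrm{inv}(I)}F_S^I(x_1,\dots,x_N;\bm{z}),$$ where $\mathfrak{c}_1(I)=\#\{r:I_r=1\}$ and $\mathrm{inv}(I)=\sum_{1\le i<j\le N}I_i(2-I_j)$; in particular $H_S=0$ if $|S|>2N$. The same formula with $M$ variables defines $H_S(y_1,\dots,y_M;\cdot)$. **The constant $c_S(q)$.** With $\mathfrak{c}_i(S)=\#\{j:S_j=i\}$ for $i=1,2$,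 $$c_S(q)=(-1)^{\mathfrak{c}_1(S)/2}(1-q)^{-\mathfrak{c}_1(S)}q^{-\mathfrak{c}_2(S)}\prod_{k\ge1}q^{2kS_k}.$$ **Sign convention.** For every integer $n$, $(-1)^{n/2}$ means $\mathrm{i}^n$ for one fixed square root $\mathrm{i}$ of $-1$, used consistently throughout (each summand in the identity is independent of this choice).
   Formalization: Convergence can fail as stated. Added: the mixed products (second-type x_i factor times first-type factors of y_j, y_j', j≠j'; and symmetrically x_i, x_i', i≠i', with y_j) are also <ε in modulus; poles are avoided uniformly in k; q≠0,1, z_k≠0, x_iy_j≠1, qx_iy_j≠1. *)

(* Defs.v *)
(* MathComp world; the complex numbers are R[i] for R : realType. *)
From HB Require Import structures.
From mathcomp Require Export all_boot all_order all_algebra finmap.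
From mathcomp Require Export complex reals.

Set Implicit Arguments.
Unset Strict Implicit.
Unset Printing Implicit Defensive.

Import Order.TTheory GRing.Theory Num.Theory.

Local Open Scope ring_scope.
Local Open Scope complex_scope.

(* Infinite vectors are indexed from 0: the entries S_(c+1) and z_(c+1) of the
   1-indexed convention are [S c] and [z c]. *)
Definition two_string := {fsfun nat -> 'I_3 with ord0}.

Definition string_weight (S : two_string) : nat :=
  (\sum_(c <- finsupp S) S c)%N.

Definition string_count (i : nat) (S : two_string) : nat :=
  count (fun c => nat_of_ord (S c) == i) (finsupp S).

(* The least L such that all nonzero entries of S are among the first L. *)
Definition string_len (S : two_string) : nat :=
  (\max_(c <- finsupp S) c.+1)%N.

Section IzerginKorepin.
Variable R : realType.
Implicit Types q x y : R[i].

(* W_(y/x)(i, j; k, l): bottom i, left j, top k, right l; x is the parameter of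
   the horizontal line and y that of the vertical one. Every entry is
   homogeneous of degree 0 in (x, y). *)
Definition IKweight q x y (i j k l : nat) : R[i] :=
  let d := x - q ^+ 2 * y in
  let D := (x - q ^+ 2 * y) * (x - q ^+ 3 * y) in
  match (i, j, k, l) with
  | (0, 0, 0, 0)%N | (2, 2, 2, 2)%N => 1
  | (1, 0, 1, 0)%N | (2, 1, 2, 1)%N => q ^+ 2 * (x - y) / d
  | (1, 0, 0, 1)%N | (2, 1, 1, 2)%N => (1 - q ^+ 2) * x / d
  | (0, 1, 1, 0)%N | (1, 2, 2, 1)%N => (1 - q ^+ 2) * y / d
  | (0, 1, 0, 1)%N | (1, 2, 1, 2)%N => (x - y) / d
  | (2, 0, 2, 0)%N => q ^+ 4 * (x - y) * (x - q * y) / D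
  | (2, 0, 1, 1)%N => - (q * (1 - q) ^+ 2 * (1 + q) * x * (x - y) / D)
  | (2, 0, 0, 2)%N =>
      (1 - q ^+ 2) * x * (x + q * x - q * y - q ^+ 3 * y) / D
  | (1, 1, 2, 0)%N => - (q ^+ 4 * (1 + q) * (x - y) * y / D)
  | (1, 1, 1, 1)%N =>
      (- q * x ^+ 2 + (1 + q) * (1 - q ^+ 2 + q ^+ 4) * x * y
       - q ^+ 4 * y ^+ 2) / D
  | (1, 1, 0, 2)%N => (1 + q) * x * (x - y) / D
  | (0, 2, 2, 0)%N =>
      (1 - q ^+ 2) * (x + q ^+ 2 * x - q ^+ 2 * y - q ^+ 3 * y) * y / D
  | (0, 2, 1, 1)%N => q * (1 - q) ^+ 2 * (1 + q) * (x - y) * y / D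
  | (0, 2, 0, 2)%N => (x - y) * (x - q * y) / D
  | _ => 0
  end.

(* The poles of [IKweight q x (z k)] are at x = q^2 z_k and x = q^3 z_k; here
   they are avoided uniformly in k, in a way that is insensitive to the scale
   of (x, z_k) and allows x = 0. *)
Definition uniformly_off_poles q x (z : nat -> R[i]) : Prop :=
  exists2 delta : R, 0 < delta & forall k : nat,
    delta%:C * (`|x| + `|z k|) <= `|x - q ^+ 2 * z k| /\
    delta%:C * (`|x| + `|z k|) <= `|x - q ^+ 3 * z k|.

Section Rows.
Variable N : nat.
Implicit Types (X : 'I_N -> R[i]) (z : nat -> R[i]) (I : {ffun 'I_N -> 'I_3}).

Definition boundary_ok L I (S : two_string)
    (h : 'M['I_3]_(N, L.+1)) (v : 'M['I_3]_(N.+1, L)) : bool :=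
  [&& [forall r, h r ord0 == I r], [forall r, h r ord_max == ord0],
      [forall c, v ord0 c == ord0] & [forall c, v ord_max c == S c]].

(* Horizontal edges h_(r,c) sit between columns, vertical edges v_(r,c) between
   rows; [widen_ord] and [lift ord0] send an index i to i and i+1. *)
Definition partition_function q L I X z (S : two_string) : R[i] :=
  \sum_(hv : 'M['I_3]_(N, L.+1) * 'M['I_3]_(N.+1, L)
        | boundary_ok I S hv.1 hv.2)
    \prod_(r < N) \prod_(c < L)
      IKweight q (X r) (z c)
        (hv.2 (widen_ord (leqnSn N) r) c) (hv.1 r (widen_ord (leqnSn L) c))
        (hv.2 (lift ord0 r) c) (hv.1 r (lift ord0 c)).

Definition IK_F q I X z (S : two_string) : R[i] :=
  partition_function q (string_len S) I X z S.

Definition comp_weight I : nat := (\sum_(r < N) I r)%N.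

Definition comp_ones I : nat := #|[set r | nat_of_ord (I r) == 1%N]|.

Definition comp_inv I : nat :=
  (\sum_(i < N) \sum_(j < N | i < j) I i * (2 - I j))%N.

(* (-1)^(n/2) is 'i ^+ n. *)
Definition IK_H q X z (S : two_string) : R[i] :=
  \sum_(I : {ffun 'I_N -> 'I_3} | comp_weight I == string_weight S)
    'i ^+ comp_ones I * (1 - q^-1) ^+ comp_ones I * q ^- comp_inv I
      * IK_F q I X z S.

End Rows.

Definition string_const q (S : two_string) : R[i] :=
  'i ^+ string_count 1 S * (1 - q) ^- string_count 1 S
    * q ^- string_count 2 S
    * \prod_(k <- finsupp S) q ^+ (2 * k.+1 * S k).

(* The family f has the sum s, independently of any ordering of T: the finite
   partial sums converge to s along the directed set of finite subsets. *)
Definition has_sum (T : choiceType) (f : T -> R[i]) (s : R[i]) : Prop :=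
  forall e : R, 0 < e -> exists A : {fset T},
    forall B : {fset T}, (A `<=` B)%fset ->
      `|\sum_(t <- B) f t - s| < e%:C.

End IzerginKorepin.

(* Main.v *)
Require Import Defs.
From mathcomp Require Import ring zify.
Import Order.TTheory GRing.Theory Num.Theory.
Local Open Scope ring_scope.
Local Open Scope complex_scope.

Set Implicit Arguments.
Unset Strict Implicit.
Unset Printing Implicit Defensive.

(** The sum over 2-strings is evaluated by gluing the two lattices into one.

    Turned upside down, the lattice of the [y_j] has, up to gauge factors, the same vertex weights
    with row parameters [1 / y_j] ([ikweight_crossing]), and the constants [c_S(q)] are exactly
    these gauge factors. Hence the sum over the strings supported in the first [L] columns is [<B|
    T(z_1) ... T(z_L) |0>]. Here [T(z)] is the operator of one column through the [N + M] rows,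
    empty at its bottom and at its top; it acts on the states [(I, J)] of the horizontal edges of
    the two lattices. The vector [|0>] is the empty state, and [B] is the boundary vector of
    entries [(-1)^(c_1/2) (1 - 1/q)^(c_1) q^(- inv)], taken on all the [N + M] rows at once.

    A vector [phi] with [T(z) phi = phi] for every [z]: if the [y] rows were below the [x] rows,
    then the state with letter 2 on the [y] rows and 0 on the [x] rows would be an eigenvector,
    because a column with this state on its right also has it on its left ([column_ground]). The
    Yang-Baxter equation ([yang_baxter]) exchanges adjacent rows, and exchanging all the pairs
    produces [phi] ([exists_eigenvector], [exists_fixed_vector]). The exchange of a pair
    multiplies the coefficient [phi_0] at the empty state by [(1 - x y) (1 - q x y)], since only
    states which dominate the expected one occur, and it multiplies [<B|phi>] by [(1 - q^2 x y) (1
    - q^3 x y)], since [B] is a left eigenvector of the R-matrix ([boundary_pairing_swap]). The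
    quotient [<B|phi> / phi_0] is thus the right-hand side, up to a power of [q].

    Contraction: a column only moves weight upwards, so [T(z)] is triangular ([column_height]).
    Its diagonal entries away from the empty state are products in which the letters of [I] and of
    [J] can be grouped as 1 with 1, 2 with 2, or one 2 with two 1; the hypotheses bound each group
    by [eps], hence the entry by [eps] ([matching_bound]). The entries are bounded uniformly in
    the column, so [T(z)] is a contraction for a weighted norm on the nonempty states
    ([contraction_step]). Writing [phi = phi_0 |0> + psi] with [psi] on nonempty states, [phi_0
    <B| T(z_1) ... T(z_L) |0>] differs from [<B|phi>] by [<B| T(z_1) ... T(z_L) psi>], which
    decays geometrically. The same estimate bounds the sum of the absolute values of the terms
    over the strings whose last nonzero letter is at a given place, so the convergence is
    unconditional ([series_estimates], [has_sum_words]). *)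

(** * Finite sums *)

Lemma sum_neq0 (V : nmodType) (I : finType) (f : I -> V) :
  \sum_i f i != 0 -> exists i, f i != 0.
Proof.
move=> h; apply/existsP; apply: contraNT h => /existsPn f0; rewrite big1 // => i _.
by apply/eqP; have := f0 i; rewrite negbK.
Qed.

Lemma exchange_big2 (V : nmodType) (A B C : finType) (H : A -> B -> C -> V) :
  \sum_a \sum_b \sum_c H a b c = \sum_c \sum_a \sum_b H a b c.
Proof. by rewrite [RHS]exchange_big; apply: eq_bigr => a _; rewrite exchange_big. Qed.

Lemma exchange_big3 (V : nmodType) (A B C D : finType) (H : A -> B -> C -> D -> V) :
  \sum_a \sum_b \sum_c \sum_d H a b c d = \sum_d \sum_a \sum_b \sum_c H a b c d.
Proof. by rewrite [RHS]exchange_big; apply: eq_bigr => a _; rewrite exchange_big2. Qed.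

Lemma exchange_big4 (V : nmodType) (A B C D E : finType) (H : A -> B -> C -> D -> E -> V) :
  \sum_a \sum_b \sum_c \sum_d \sum_e H a b c d e =
  \sum_e \sum_a \sum_b \sum_c \sum_d H a b c d e.
Proof. by rewrite [RHS]exchange_big; apply: eq_bigr => a _; rewrite exchange_big3. Qed.

Lemma big_ord3 (V : nmodType) (G : 'I_3 -> V) :
  \sum_(m < 3) G m = G (@Ordinal 3 0 isT) + G (@Ordinal 3 1 isT) + G (@Ordinal 3 2 isT).
Proof.
by rewrite !big_ord_recl big_ord0 addr0 addrA; congr (G _ + G _ + G _); apply/val_inj.
Qed.

Lemma big_subseq_split (T : eqType) (V : nmodType) (s1 s2 : seq T) (g : T -> V) :
  uniq s1 -> uniq s2 -> {subset s1 <= s2} ->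
  \sum_(i <- s2) g i = \sum_(i <- s1) g i + \sum_(i <- s2 | i \notin s1) g i.
Proof.
move=> u1 u2 sub; rewrite (bigID (mem s1)) /=; congr (_ + _).
rewrite -big_filter; apply: perm_big; apply: uniq_perm => //; first exact: filter_uniq.
by move=> i; rewrite mem_filter andb_idr //; exact: sub.
Qed.

Lemma ler_sum_in (F : numDomainType) (T : eqType) (r : seq T) (Q : pred T) (f g : T -> F) :
  (forall i, i \in r -> Q i -> f i <= g i) ->
  \sum_(i <- r | Q i) f i <= \sum_(i <- r | Q i) g i.
Proof.
move=> H; rewrite big_seq_cond [X in _ <= X]big_seq_cond.
by apply: ler_sum => i /andP[]; exact: H.
Qed.

(** * Words over three letters *)

(** The words of length [n] in the letters 0, 1, 2: the states of the edges cut by a line. *)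
Fixpoint words (n : nat) : seq (seq nat) :=
  if n is n'.+1 then [seq a :: K | a <- iota 0 3, K <- words n'] else [:: [::]].

Arguments words : simpl never.

Lemma mem_words n K : (K \in words n) = (size K == n) && all (fun a => a < 3)%N K.
Proof.
elim: n K => [|n IH] K; first by rewrite mem_seq1; case: K.
apply/allpairsP/idP => [[[b L] [hb hL ->]]|].
  by move: hb hL; rewrite mem_iota IH /= => -> /andP[/eqP -> ->]; rewrite eqxx.
case: K => [//|a K]; rewrite /= eqSS => /and3P[sK ha hK].
exists (a, K); split=> //=; last by rewrite IH sK hK.
by case: a ha => [|[|[|]]].
Qed.

Lemma words_uniq n : uniq (words n).
Proof.
elim: n => [//|n IH]; apply: (allpairs_uniq (iota_uniq 0 3) IH).
by move=> [a K] [b L] _ _ [-> ->].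
Qed.

Lemma big_words0 (V : nmodType) (g : seq nat -> V) : \sum_(K <- words 0) g K = g [::].
Proof. by rewrite big_seq1. Qed.

Lemma big_wordsS (V : nmodType) n (g : seq nat -> V) :
  \sum_(K <- words n.+1) g K = \sum_(a < 3) \sum_(K <- words n) g (nat_of_ord a :: K).
Proof.
rewrite (_ : words n.+1 = [seq a :: K | a <- iota 0 3, K <- words n]) //.
rewrite big_allpairs_dep /=.
by rewrite !big_cons big_nil !big_ord_recl big_ord0.
Qed.

Lemma words_letter L w : w \in words L -> forall a, a \in w -> (a < 3)%N.
Proof. by rewrite mem_words => /andP[_ /allP]. Qed.

Lemma sum_words_delta (F : pzRingType) n (K0 : seq nat) (h : seq nat -> F) : K0 \in words n ->
  \sum_(K <- words n) h K * (K == K0)%:R = h K0.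
Proof.
move=> hK; rewrite (bigD1_seq K0) ?words_uniq //= eqxx mulr1 big1 ?addr0 // => K /negPf ->.
by rewrite mulr0.
Qed.

Lemma sum_words_cat (V : nmodType) n m (g : seq nat -> V) :
  \sum_(K <- words (n + m)) g K = \sum_(I <- words n) \sum_(J <- words m) g (I ++ J).
Proof.
elim: n g => [|n IH] g; first by rewrite big_words0.
by rewrite addSn !big_wordsS; apply: eq_bigr => a _; rewrite IH.
Qed.

Lemma big_words_rcons (V : nmodType) L (g : seq nat -> V) :
  \sum_(w <- words L.+1) g w = \sum_(w <- words L) \sum_(a < 3) g (rcons w a).
Proof.
rewrite -addn1 sum_words_cat; apply: eq_bigr => w _.
rewrite big_wordsS; apply: eq_bigr => a _; rewrite big_words0.
by rewrite cats1.
Qed.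

(** * The vertex weights and the Yang-Baxter equation *)

Section Weights.
Variable F : fieldType.
Implicit Types q x y : F.

(** The vertex weight multiplied by [(x - q^2 y) (x - q^3 y)], with the arguments in the order
    bottom, left, top, right. It is a quadratic form in the parameters [x] of the row and [y] of
    the column, so that a row of parameter [1 / y] can be written with the pair [(1, y)], also
    when [y = 0]. *)
Definition ikpoly q x y (i j k l : nat) : F :=
  let d := x - q ^+ 3 * y in
  match (i, j, k, l) with
  | (0, 0, 0, 0)%N | (2, 2, 2, 2)%N => (x - q ^+ 2 * y) * d
  | (1, 0, 1, 0)%N | (2, 1, 2, 1)%N => q ^+ 2 * (x - y) * d
  | (1, 0, 0, 1)%N | (2, 1, 1, 2)%N => (1 - q ^+ 2) * x * d
  | (0, 1, 1, 0)%N | (1, 2, 2, 1)%N => (1 - q ^+ 2) * y * d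
  | (0, 1, 0, 1)%N | (1, 2, 1, 2)%N => (x - y) * d
  | (2, 0, 2, 0)%N => q ^+ 4 * (x - y) * (x - q * y)
  | (2, 0, 1, 1)%N => - (q * (1 - q) ^+ 2 * (1 + q) * x * (x - y))
  | (2, 0, 0, 2)%N => (1 - q ^+ 2) * x * (x + q * x - q * y - q ^+ 3 * y)
  | (1, 1, 2, 0)%N => - (q ^+ 4 * (1 + q) * (x - y) * y)
  | (1, 1, 1, 1)%N =>
      - q * x ^+ 2 + (1 + q) * (1 - q ^+ 2 + q ^+ 4) * x * y - q ^+ 4 * y ^+ 2
  | (1, 1, 0, 2)%N => (1 + q) * x * (x - y)
  | (0, 2, 2, 0)%N => (1 - q ^+ 2) * (x + q ^+ 2 * x - q ^+ 2 * y - q ^+ 3 * y) * y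
  | (0, 2, 1, 1)%N => q * (1 - q) ^+ 2 * (1 + q) * (x - y) * y
  | (0, 2, 0, 2)%N => (x - y) * (x - q * y)
  | _ => 0
  end.

Lemma ikpoly_conserve q x y i j k l :
  ikpoly q x y i j k l != 0 -> (i + j = k + l)%N.
Proof.
by move: i j k l => [|[|[|i]]] [|[|[|j]]] [|[|[|k]]] [|[|[|l]]];
  rewrite /ikpoly ?eqxx.
Qed.

(** The Yang-Baxter equation for a row of parameter [x], a row of parameter [1 / y] and a column
    of parameter [z]. The R-matrix is the vertex weight at the ratio [x y] with its outgoing edges
    exchanged. *)
Lemma yang_baxter q x y z (i j1 j2 m2 a b : 'I_3) :
  \sum_(m1 < 3) \sum_(l1 < 3) \sum_(l2 < 3)
    ikpoly q x z i j1 m1 l1 * ikpoly q 1 (y * z) m1 j2 m2 l2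
      * ikpoly q 1 (x * y) l1 l2 b a =
  \sum_(m1 < 3) \sum_(l1 < 3) \sum_(l2 < 3)
    ikpoly q 1 (x * y) j1 j2 l2 l1
    * (ikpoly q 1 (y * z) i l1 m1 a * ikpoly q x z m1 l2 m2 b).
Proof.
(* Both sides vanish unless the total weight is conserved; this leaves 141 polynomial identities. *)
have [E|E] := eqVneq (i + j1 + j2)%N (m2 + a + b)%N; last first.
  have zero (u v w : F) : (u != 0 -> v != 0 -> w = 0) -> u * (v * w) = 0.
    have [-> _|hu] := eqVneq u 0; first by rewrite mul0r.
    have [-> _|hv] := eqVneq v 0; first by rewrite mul0r mulr0.
    by move=> ->; rewrite ?mulr0.
  rewrite !big1 // => m1 _; rewrite big1 // => l1 _; rewrite big1 // => l2 _;
    rewrite -?mulrA; apply: zero => /ikpoly_conserve E1 /ikpoly_conserve E2;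
    apply/eqP; apply: contraT => /ikpoly_conserve E3; case/eqP: E; lia.
(* The sums are unfolded over natural numbers, so that the case analysis is done before the weights
   are expanded. *)
pose s3 (g : nat -> F) := g 0%N + g 1%N + g 2%N.
pose P (i j1 j2 m2 a b : nat) :=
  s3 (fun m1 => s3 (fun l1 => s3 (fun l2 =>
    ikpoly q x z i j1 m1 l1 * ikpoly q 1 (y * z) m1 j2 m2 l2
      * ikpoly q 1 (x * y) l1 l2 b a))) =
  s3 (fun m1 => s3 (fun l1 => s3 (fun l2 =>
    ikpoly q 1 (x * y) j1 j2 l2 l1
    * (ikpoly q 1 (y * z) i l1 m1 a * ikpoly q x z m1 l2 m2 b)))).
rewrite !big_ord3.
change (P i j1 j2 m2 a b).
move: (nat_of_ord i) (nat_of_ord j1) (nat_of_ord j2) (nat_of_ord m2) (nat_of_ord a)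
  (nat_of_ord b) (ltn_ord i) (ltn_ord j1) (ltn_ord j2) (ltn_ord m2) (ltn_ord a) (ltn_ord b) E.
clear i j1 j2 m2 a b; move=> [|[|[|//]]] [|[|[|//]]] [|[|[|//]]] [|[|[|//]]] [|[|[|//]]]
  [|[|[|//]]] _ _ _ _ _ _ E; try discriminate E; clear E.
all: cbv beta iota zeta delta [P s3 ikpoly].
all: ring.
Qed.

End Weights.

(** * The operator of one column *)

Section Transfer.
Variables (F : fieldType) (P : Type).
Implicit Types (w : P -> nat -> nat -> nat -> nat -> F) (ps : seq P) (f : seq nat -> F).

(** The partition function of one column. The rows [ps] are listed from the bottom, [i] and [k]
    are the edges at the bottom and at the top, [J] and [L] the states on the left and on the
    right. It is 0 unless [J] and [L] have one letter for each row. *)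
Fixpoint column w ps (i k : nat) (J L : seq nat) : F :=
  match ps, J, L with
  | p :: ps', j :: J', l :: L' => \sum_(m < 3) w p i j m l * column w ps' m k J' L'
  | [::], [::], [::] => (i == k)%:R
  | _, _, _ => 0
  end.

(** The operator of a column: it maps a function of the state on its right to a function of the
    state on its left. *)
Definition transfer w ps i k f J : F :=
  \sum_(L <- words (size ps)) column w ps i k J L * f L.

Lemma transfer_cons w p ps i k f j J :
  transfer w (p :: ps) i k f (j :: J) =
  \sum_(m < 3) \sum_(l < 3) w p i j m l * transfer w ps m k (fun L => f (nat_of_ord l :: L)) J.
Proof.
rewrite /transfer big_wordsS [RHS]exchange_big; apply: eq_bigr => l _ /=.
rewrite (eq_bigr (fun L => \sum_(m < 3) w p i j m l * column w ps m k J L * f (nat_of_ord l :: L))).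
  rewrite exchange_big /=; apply: eq_bigr => m _.
  by rewrite mulr_sumr; apply: eq_bigr => L _; rewrite mulrA.
by move=> L _; rewrite mulr_suml.
Qed.

Lemma eq_transfer w ps i k f g J : f =1 g -> transfer w ps i k f J = transfer w ps i k g J.
Proof. by move=> fg; apply: eq_bigr => L _; rewrite fg. Qed.

Lemma transfer_sum (I : finType) w ps i k (c : I -> F) (f : I -> seq nat -> F) J :
  transfer w ps i k (fun L => \sum_a c a * f a L) J = \sum_a c a * transfer w ps i k (f a) J.
Proof.
under [RHS]eq_bigr do rewrite mulr_sumr.
rewrite [RHS]exchange_big; apply: eq_bigr => L _; rewrite mulr_sumr.
by apply: eq_bigr => a _; rewrite mulrCA.
Qed.

(** The action of a matrix [r] on the letters in positions [n] and [n + 1] (from 0); the value at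
    a word without these letters is 0. *)
Fixpoint swap_at (r : nat -> nat -> nat -> nat -> F) (n : nat) f (K : seq nat) : F :=
  match n, K with
  | 0, a :: b :: K' => \sum_(u < 3) \sum_(v < 3) r a b u v * f (nat_of_ord u :: nat_of_ord v :: K')
  | n'.+1, a :: K' => swap_at r n' (fun L => f (a :: L)) K'
  | _, _ => 0
  end.

Lemma swap_at_sum (I : finType) r n (c : I -> F) (f : I -> seq nat -> F) K :
  swap_at r n (fun L => \sum_a c a * f a L) K = \sum_a c a * swap_at r n (f a) K.
Proof.
elim: n f K => [|n IH] f [|a [|b K]] /=; try by rewrite big1 // => ? _; rewrite mulr0.
- under [RHS]eq_bigr do rewrite mulr_sumr; rewrite [RHS]exchange_big; apply: eq_bigr => u _.
  under [RHS]eq_bigr do rewrite mulr_sumr; rewrite [RHS]exchange_big; apply: eq_bigr => v _.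
  by rewrite mulr_sumr; apply: eq_bigr => d _; rewrite mulrCA.
- exact: (IH (fun d L => f d (a :: L))).
- exact: (IH (fun d L => f d (a :: L))).
Qed.

Lemma eq_swap_at r n f g K : f =1 g -> swap_at r n f K = swap_at r n g K.
Proof.
elim: n f g K => [|n IH] f g [|a [|b K]] //= fg; try by apply: IH => L; rewrite fg.
by apply: eq_bigr => u _; apply: eq_bigr => v _; rewrite fg.
Qed.

Lemma eq_swap_at_words r n N f g K : {in words N, f =1 g} -> K \in words N ->
  swap_at r n f K = swap_at r n g K.
Proof.
elim: n N f g K => [|n IH] [|N] f g [|a [|b K]]; rewrite ?mem_words //= => fg hK.
  apply: eq_bigr => u _; apply: eq_bigr => v _; congr (_ * _); apply: fg.
  rewrite mem_words /= !ltn_ord /=.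
  by move: hK; rewrite eqSS; case/and4P=> -> _ _ ->.
all: move: hK; rewrite eqSS => /and3P[sK ha hK]; apply: (IH N); last by rewrite mem_words /= sK.
all: by move=> L; rewrite mem_words => hL; apply: fg; rewrite mem_words /= eqSS ha andbA andbAC hL.
Qed.

Lemma swap_at_cat r f A a b K :
  swap_at r (size A) f (A ++ a :: b :: K) =
  \sum_(u < 3) \sum_(v < 3) r a b u v * f (A ++ nat_of_ord u :: nat_of_ord v :: K).
Proof. by elim: A f => [//|c A IH] f /=; rewrite IH. Qed.

Lemma swap_at_short r f n K : (size K < n.+2)%N -> swap_at r n f K = 0.
Proof.
elim: n f K => [|n IH] f [|a [|b K]] //= sK; first by rewrite IH.
by rewrite IH //= -ltnS.
Qed.

(** The Yang-Baxter equation intertwines the column operators of two orders of the rows. *)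
Lemma transfer_swap w p p' (r : nat -> nat -> nat -> nat -> F) l1 l2 i k f J :
  (forall i j1 j2 m a b : 'I_3,
     \sum_(m1 < 3) \sum_(u < 3) \sum_(v < 3) w p i j1 m1 u * w p' m1 j2 m v * r u v a b =
     \sum_(m1 < 3) \sum_(u < 3) \sum_(v < 3) r j1 j2 u v * (w p' i u m1 a * w p m1 v m b)) ->
  (i < 3)%N -> J \in words (size (l1 ++ p :: p' :: l2)) ->
  transfer w (l1 ++ p :: p' :: l2) i k (swap_at r (size l1) f) J =
  swap_at r (size l1) (transfer w (l1 ++ p' :: p :: l2) i k f) J.
Proof.
move=> YB; elim: l1 i f J => [|p1 l1 IH] i f [|j1 J]; rewrite ?mem_words //; last first.
  move=> hi; rewrite /= eqSS => /and3P[sJ hj hJ].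
  rewrite transfer_cons.
  have -> : swap_at r (size l1) (fun L => transfer w (p1 :: l1 ++ [:: p', p & l2]) i k f (j1 :: L)) J =
    \sum_(m < 3) \sum_(l < 3) w p1 i j1 m l *
      swap_at r (size l1) (transfer w (l1 ++ [:: p', p & l2]) m k (fun L => f (nat_of_ord l :: L))) J.
    under eq_swap_at => L do rewrite transfer_cons pair_bigA /=.
    by rewrite swap_at_sum pair_bigA.
  apply: eq_bigr => m _; apply: eq_bigr => l _; rewrite IH ?ltn_ord //.
  by rewrite mem_words sJ.
case: J => [|j2 J] //= hi /and4P[sJ h1 h2 hJ].
pose G (m a b : nat) := transfer w l2 m k (fun L => f (a :: b :: L)) J.
transitivity (\sum_(m1 < 3) \sum_(u < 3) \sum_(m < 3) \sum_(v < 3) \sum_(a < 3) \sum_(b < 3)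
   w p i j1 m1 u * w p' m1 j2 m v * r u v a b * G m a b).
  rewrite transfer_cons; apply: eq_bigr => m1 _; apply: eq_bigr => u _.
  rewrite transfer_cons mulr_sumr; apply: eq_bigr => m _; rewrite mulr_sumr; apply: eq_bigr => v _.
  under eq_transfer => L do rewrite pair_bigA /=.
  rewrite transfer_sum pair_bigA /= !mulr_sumr; apply: eq_bigr => ab _.
  by rewrite !mulrA.
symmetry.
transitivity (\sum_(u < 3) \sum_(v < 3) \sum_(m1 < 3) \sum_(a < 3) \sum_(m < 3) \sum_(b < 3)
   r j1 j2 u v * (w p' i u m1 a * w p m1 v m b) * G m a b).
  apply: eq_bigr => u _; apply: eq_bigr => v _.
  rewrite transfer_cons mulr_sumr; apply: eq_bigr => m1 _; rewrite mulr_sumr; apply: eq_bigr => a _.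
  rewrite transfer_cons !mulr_sumr; apply: eq_bigr => m _; rewrite !mulr_sumr; apply: eq_bigr => b _.
  by rewrite !mulrA.
transitivity (\sum_(m < 3) \sum_(a < 3) \sum_(b < 3) (\sum_(m1 < 3) \sum_(u < 3) \sum_(v < 3)
   r j1 j2 u v * (w p' i u m1 a * w p m1 v m b)) * G m a b).
  rewrite exchange_big4; apply: eq_bigr => m _.
  rewrite exchange_big3; apply: eq_bigr => a _.
  rewrite exchange_big3; apply: eq_bigr => b _.
  rewrite exchange_big2 mulr_suml; apply: eq_bigr => m1 _; rewrite mulr_suml.
  by apply: eq_bigr => u _; rewrite mulr_suml.
transitivity (\sum_(m < 3) \sum_(a < 3) \sum_(b < 3) (\sum_(m1 < 3) \sum_(u < 3) \sum_(v < 3)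
   w p i j1 m1 u * w p' m1 j2 m v * r u v a b) * G m a b).
  apply: eq_bigr => m _; apply: eq_bigr => a _; apply: eq_bigr => b _; congr (_ * _).
  by rewrite (YB (Ordinal hi) (Ordinal h1) (Ordinal h2)).
symmetry; rewrite exchange_big2; apply: eq_bigr => m _.
rewrite exchange_big3; apply: eq_bigr => a _.
rewrite exchange_big3; apply: eq_bigr => b _.
rewrite mulr_suml; apply: eq_bigr => m1 _; rewrite mulr_suml.
by apply: eq_bigr => u _; rewrite mulr_suml.
Qed.

End Transfer.

(** * The boundary vector *)

Section Boundary.
Variable F : fieldType.
Variables (q e : F).
Hypothesis (hq : q != 0) (he : e ^+ 2 = - (1 - q^-1) ^+ 2).
Implicit Types (x y z : F) (f : seq nat -> F) (ps : seq (bool * F)).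

(** The factor of the boundary weight due to a letter [a] preceded by letters of sum [s]; the
    parameter [e] stands for [i (1 - 1/q)], of which only the square matters for the R-matrix. *)
Definition boundary_factor (s a : nat) : F :=
  (if a == 1%N then e else 1) * q^-1 ^+ (s * (2 - a)).

(** The coefficient [e^(c_1(K)) q^(- inv(K))] of the boundary vector when [s = 0]; the letters of
    sum [s] are those read before [K]. *)
Fixpoint boundary_weight (s : nat) (K : seq nat) : F :=
  if K is a :: K' then boundary_factor s a * boundary_weight (s + a) K' else 1.

Definition boundary_pairing n s f : F := \sum_(K <- words n) boundary_weight s K * f K.

Lemma boundary_pairingS n s f :
  boundary_pairing n.+1 s f =
  \sum_(a < 3) boundary_factor s a * boundary_pairing n (s + a) (fun K => f (nat_of_ord a :: K)).
Proof.
rewrite /boundary_pairing big_wordsS; apply: eq_bigr => a _.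
by rewrite mulr_sumr; apply: eq_bigr => K _; rewrite mulrA.
Qed.

Lemma boundary_pairing_sum (I : finType) n s (c : I -> F) (f : I -> seq nat -> F) :
  boundary_pairing n s (fun K => \sum_i c i * f i K) = \sum_i c i * boundary_pairing n s (f i).
Proof.
under [RHS]eq_bigr do rewrite mulr_sumr; rewrite [RHS]exchange_big.
apply: eq_bigr => K _; rewrite mulr_sumr; apply: eq_bigr => i _; exact: mulrCA.
Qed.

Lemma eq_boundary_pairing n s f g :
  f =1 g -> boundary_pairing n s f = boundary_pairing n s g.
Proof. by move=> fg; apply: eq_bigr => K _; rewrite fg. Qed.

(** The R-matrix which exchanges a row of parameter [x] and a row of parameter [1 / y]. *)
Definition crossing x y (a b u v : nat) : F := ikpoly q 1 (x * y) a b v u.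
(** The eigenvalue of [crossing] on the boundary vector. *)
Definition crossing_scale x y : F := (1 - q ^+ 2 * (x * y)) * (1 - q ^+ 3 * (x * y)).

(** The boundary weights of two adjacent letters form a left eigenvector of the R-matrix. The rest
    of the boundary weight depends on these two letters only through their sum, which the R-matrix
    preserves; it is represented by [H]. *)
Lemma boundary_factor_crossing x y s (H : nat -> F) (u v : 'I_3) :
  \sum_(a < 3) \sum_(b < 3)
    boundary_factor s a * boundary_factor (s + a) b * crossing x y a b u v * H (a + b)%N
  = crossing_scale x y * (boundary_factor s u * boundary_factor (s + u) v * H (u + v)%N).
Proof.
(* [beta a b] is the weight of the two letters, with [e ^+ 2] replaced by its value. *)
pose t := q^-1 ^+ s.
pose beta a b : F := (if (a == 1)%N && (b == 1)%N then - (1 - q^-1) ^+ 2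
  else if (a == 1)%N || (b == 1)%N then e else 1) *
  (t ^+ (2 - a) * t ^+ (2 - b) * q^-1 ^+ (a * (2 - b))).
have betaE a b : boundary_factor s a * boundary_factor (s + a) b = beta a b.
  rewrite /beta /boundary_factor /t -he mulnDl [in q^-1 ^+ (_ + _)]exprD -!exprM.
  by case: (a == 1%N); case: (b == 1%N) => /=; rewrite ?mulr1; ring.
under eq_bigr => a _ do under eq_bigr => b _ do rewrite betaE.
rewrite betaE !big_ord3 /crossing /crossing_scale.
case: u => [[|[|[|//]]] ?]; case: v => [[|[|[|//]]] ?];
cbv beta iota zeta delta [beta ikpoly nat_of_ord]; rewrite /= ?mulr0 ?mul0r ?addr0 ?add0r.
all: by field.
Qed.

Lemma boundary_pairing_swap x y n k s f : (k.+2 <= n)%N ->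
  boundary_pairing n s (swap_at (crossing x y) k f) = crossing_scale x y * boundary_pairing n s f.
Proof.
elim: k n s f => [|k IH] [|[|n]] s f // hk; last first.
  rewrite !boundary_pairingS mulr_sumr; apply: eq_bigr => a _ /=.
  by rewrite IH // mulrCA.
rewrite boundary_pairingS.
have -> : boundary_pairing n.+2 s f = \sum_(u < 3) \sum_(v < 3) boundary_factor s u *
     boundary_factor (s + u) v * boundary_pairing n (s + (u + v))
       (fun K => f (nat_of_ord u :: nat_of_ord v :: K)).
  rewrite boundary_pairingS; apply: eq_bigr => u _; rewrite boundary_pairingS mulr_sumr.
  by apply: eq_bigr => v _; rewrite mulrA addnA.
transitivity (\sum_(a < 3) \sum_(b < 3) \sum_(u < 3) \sum_(v < 3)
  boundary_factor s a * boundary_factor (s + a) b * crossing x y a b u v *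
  boundary_pairing n (s + (a + b)) (fun K => f (nat_of_ord u :: nat_of_ord v :: K))).
  apply: eq_bigr => a _; rewrite boundary_pairingS mulr_sumr; apply: eq_bigr => b _.
  rewrite -addnA; under eq_boundary_pairing => K do rewrite /= pair_bigA /=.
  rewrite boundary_pairing_sum !mulr_sumr pair_bigA /=; apply: eq_bigr => uv _.
  by rewrite !mulrA.
rewrite exchange_big3; under eq_bigr do rewrite exchange_big2.
rewrite exchange_big mulr_sumr; apply: eq_bigr => u _.
rewrite mulr_sumr; apply: eq_bigr => v _.
exact: (boundary_factor_crossing x y s (fun m => boundary_pairing n (s + m)
  (fun K => f (nat_of_ord u :: nat_of_ord v :: K)))).
Qed.

End Boundary.

(** * Exchanging rows: a common eigenvector of the column operators *)

Section Eigenvector.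
Variable F : fieldType.
Variables (q e : F).
Hypothesis (hq : q != 0) (he : e ^+ 2 = - (1 - q^-1) ^+ 2).
Implicit Types (x y z : F) (f : seq nat -> F) (p : bool * F) (ps : seq (bool * F)).

(** Rows come in two kinds: [(false, x)] is a row of parameter [x], and [(true, y)] is a row of
    parameter [1 / y], as it arises from the lattice of the [y_j]. *)
Definition row_weight z p (i j k l : nat) : F :=
  if p.1 then ikpoly q 1 (p.2 * z) i j k l else ikpoly q p.2 z i j k l.

(** The weight of the vertex with empty vertical edges and the ground letter on its row. *)
Definition row_scale z p : F :=
  if p.1 then (1 - p.2 * z) * (1 - q * (p.2 * z))
  else (p.2 - q ^+ 2 * z) * (p.2 - q ^+ 3 * z).

(** The ground state: letter 2 on the rows of kind [true] and 0 on the others. *)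
Definition ground ps : seq nat := [seq if p.1 then 2%N else 0%N | p <- ps].

(** [f] is an eigenvector, for all column parameters at once, of the column operator with empty
    bottom and top, the eigenvalue being the product of the [row_scale]; [c] is its coefficient at
    the ground state and [b] its pairing with the boundary vector. Its support consists of words
    of the weight of the ground state which dominate it, in the sense of prefix sums. *)
Definition is_eigenvector ps f (c b : F) : Prop :=
  [/\ forall K, f K != 0 -> sumn K = sumn (ground ps) /\
        (forall k, sumn (take k (ground ps)) <= sumn (take k K))%N,
      f (ground ps) = c,
      boundary_pairing q e (size ps) 0 f = b
    & forall z J, J \in words (size ps) ->
        transfer (row_weight z) ps 0 0 f J = \prod_(p <- ps) row_scale z p * f J].

Lemma row_weight_conserve z p i j k l : row_weight z p i j k l != 0 -> (i + j = k + l)%N.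
Proof. by rewrite /row_weight; case: ifP => _ /ikpoly_conserve. Qed.

Lemma ground_words ps : ground ps \in words (size ps).
Proof. by rewrite mem_words size_map eqxx all_map; apply/allP => p _ /=; case: p.1. Qed.

Lemma column_zeros z xs i J :
  column (row_weight z) [seq (false, x) | x <- xs] i 0 J (nseq (size xs) 0%N) =
  \prod_(p <- [seq (false, x) | x <- xs]) row_scale z p * ((i == 0%N) && (J == nseq (size xs) 0%N))%:R.
Proof.
elim: xs i J => [|x xs IH] i [|j J] /=; rewrite ?(andbF, mulr0) //.
  by rewrite big_nil mul1r andbT.
rewrite big_ord_recl big1 ?addr0 => [|m _]; last by rewrite IH /= !mulr0.
rewrite IH /= big_cons eqseq_cons mulrA [X in X * _]mulrC.
case: (altP (i =P 0%N)) => [->|hi] /=.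
  case: j => [|j] /=; last by case: j => [|[|j]]; rewrite /row_weight /ikpoly /= ?mulr0 ?mul0r.
  by rewrite /row_weight /row_scale /ikpoly /= [X in X * _ = _]mulrC.
rewrite mulr0 (_ : row_weight _ _ _ _ _ _ = 0) ?mulr0 ?mul0r //.
apply/eqP; apply: contraT => /row_weight_conserve; lia.
Qed.

(** When the rows of kind [true] are below the others, a column with the ground state on its right
    has the ground state on its left. *)
Lemma column_ground z ys xs J :
  column (row_weight z) ([seq (true, y) | y <- ys] ++ [seq (false, x) | x <- xs]) 0 0 J
    (ground ([seq (true, y) | y <- ys] ++ [seq (false, x) | x <- xs])) =
  \prod_(p <- [seq (true, y) | y <- ys] ++ [seq (false, x) | x <- xs]) row_scale z p *
  (J == ground ([seq (true, y) | y <- ys] ++ [seq (false, x) | x <- xs]))%:R.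
Proof.
elim: ys J => [|y ys IH] J /=.
  have -> : ground [seq (false, x) | x <- xs] = nseq (size xs) 0%N.
    by rewrite /ground -map_comp; elim: xs => //= x xs ->.
  exact: column_zeros.
case: J => [|j J] /=; first by rewrite mulr0.
rewrite big_ord_recl big1 ?addr0 => [|m _]; last first.
  rewrite (_ : row_weight _ _ _ _ _ _ = 0) ?mul0r //; apply/eqP; apply: contraT.
  move=> h; have := row_weight_conserve h; move: h; rewrite /row_weight /ikpoly.
  by case: j => [|[|[|j]]]; case: m => [[|[|m]] ?]; rewrite /= ?eqxx //; lia.
rewrite IH /= big_cons eqseq_cons !mulrA.
case: (altP (j =P 2%N)) => [->|hj] /=.
  by rewrite /row_weight /row_scale /ikpoly.
rewrite mulr0 (_ : row_weight _ _ _ _ _ _ = 0) ?mul0r //.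
apply/eqP; apply: contraT => /row_weight_conserve; lia.
Qed.

Lemma boundary_weight_ground ys xs s :
  boundary_weight q e s (ground ([seq (true, y) | y <- ys] ++ [seq (false, x) | x <- xs])) =
  q^-1 ^+ (2 * (s + 2 * size ys) * size xs).
Proof.
elim: ys s => [|y ys IH] s /=.
  elim: xs s => [|x xs IH] s /=; first by rewrite muln0.
  by rewrite IH /boundary_factor /= mul1r -exprD; congr (_ ^+ _); lia.
by rewrite IH /boundary_factor /= muln0 expr0 !mul1r; congr (_ ^+ _); lia.
Qed.

Lemma is_eigenvector_ground ys xs (ps := [seq (true, y) | y <- ys] ++ [seq (false, x) | x <- xs]) :
  is_eigenvector ps (fun K => (K == ground ps)%:R) 1 (q^-1 ^+ (4 * size ys * size xs)).
Proof.
split.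
- by move=> K; case: (K =P ground ps) => [-> //|_]; rewrite eqxx.
- by rewrite eqxx.
- rewrite /boundary_pairing (@sum_words_delta _ _ _ (boundary_weight q e 0)) ?ground_words //.
  rewrite /ps boundary_weight_ground.
  by congr (_ ^+ _); lia.
- by move=> z J hJ; rewrite /transfer sum_words_delta ?ground_words // column_ground.
Qed.

(** Exchange of a row of kind [true] with the row of kind [false] above it. *)
Lemma is_eigenvector_swap l1 l2 x y f c b
  (ps := l1 ++ (true, y) :: (false, x) :: l2) (ps' := l1 ++ (false, x) :: (true, y) :: l2) :
  is_eigenvector ps f c b ->
  is_eigenvector ps' (swap_at (crossing q x y) (size l1) f)
    ((1 - x * y) * (1 - q * (x * y)) * c) (crossing_scale q x y * b).
Proof.
case=> supp fc fb eig.
have groundE : ground ps = ground l1 ++ 2%N :: 0%N :: ground l2 by rewrite /ground map_cat.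
have groundE' : ground ps' = ground l1 ++ 0%N :: 2%N :: ground l2 by rewrite /ground map_cat.
have sizeE : size ps' = size ps by rewrite !size_cat.
have size_ground l : size (ground l) = size l by rewrite size_map.
split.
- move=> K hK.
  have sK : ((size l1).+2 <= size K)%N.
    by rewrite leqNgt; apply: contra hK => hs; rewrite swap_at_short.
  have [A [a [d [C [sA EK]]]]] : exists A a d C, size A = size l1 /\ K = A ++ a :: d :: C.
    exists (take (size l1) K), (nth 0%N K (size l1)), (nth 0%N K (size l1).+1), (drop (size l1).+2 K).
    by rewrite size_takel -?drop_nth ?cat_take_drop //; lia.
  move: hK; rewrite EK -sA swap_at_cat => /sum_neq0[u /sum_neq0[v]].
  rewrite mulf_eq0 negb_or => /andP[/ikpoly_conserve hr /supp[]].
  rewrite groundE groundE' !sumn_cat /= => hs hd; split; first by lia.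
  move=> k; have := hd k; have := hd (size l1).
  rewrite !take_cat sA size_ground ltnn subnn !take0 !cats0.
  case: ltnP => // hk; rewrite !sumn_cat.
  case E: (k - size l1)%N => [|[|m]] /=; rewrite ?take0; lia.
- rewrite groundE' -(size_ground l1) swap_at_cat.
  (* Only [u = 2], [v = 0] contributes: dominance excludes a smaller [u], and weight conservation
     then forces [v]. *)
  rewrite (bigD1 (@Ordinal 3 2 isT)) //= (bigD1 (@Ordinal 3 0 isT)) //= !big1 ?addr0.
  + by rewrite -groundE fc; congr (_ * _); rewrite /crossing /ikpoly.
  + move=> u hu; rewrite big1 // => v _; apply/eqP; apply: contraT.
    rewrite mulf_eq0 negb_or => /andP[/ikpoly_conserve hr /supp[_ /(_ (size l1).+1)]].
    rewrite groundE !take_cat size_ground ltnNge leqnSn /= subSn // subnn /= ?take0 !sumn_cat /=.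
    by move: hu; rewrite -val_eqE /=; have := ltn_ord u; lia.
  + move=> v hv; rewrite (_ : crossing _ _ _ _ _ _ _ = 0) ?mul0r //; apply/eqP; apply: contraT.
    by move/ikpoly_conserve; move: hv; rewrite -val_eqE /=; lia.
- by rewrite boundary_pairing_swap ?sizeE ?fb // size_cat /=; lia.
- move=> z J hJ; rewrite transfer_swap // => [|i j1 j2 m a d]; last exact: yang_baxter.
  (* The scalar is written as a sum with one term, so that [swap_at_sum] pulls it out. *)
  transitivity (swap_at (crossing q x y) (size l1)
    (fun L => \sum_(i < 1) (\prod_(p <- ps) row_scale z p) * f L) J).
    by apply: (eq_swap_at_words _ _ _ hJ) => L; rewrite sizeE => hL; rewrite eig // big_ord1.
  rewrite swap_at_sum big_ord1; congr (_ * _).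
  by rewrite /ps /ps' !big_cat !big_cons /= [X in _ * X]mulrCA.
Qed.

Lemma is_eigenvector_move ys l1 l2 x f c b :
  is_eigenvector (l1 ++ [seq (true, y) | y <- ys] ++ (false, x) :: l2) f c b ->
  exists f', is_eigenvector (l1 ++ (false, x) :: [seq (true, y) | y <- ys] ++ l2) f'
    (\prod_(y <- ys) ((1 - x * y) * (1 - q * (x * y))) * c)
    (\prod_(y <- ys) crossing_scale q x y * b).
Proof.
elim/last_ind: ys l2 f c b => [|ys y IH] l2 f c b.
  by move=> hf; exists f; rewrite !big_nil !mul1r.
rewrite map_rcons !cat_rcons catA => /is_eigenvector_swap; rewrite -catA => /IH[f' hf'].
by exists f'; move: hf'; rewrite -!cats1 !big_cat /= !big_seq1 !mulrA.
Qed.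

Lemma exists_eigenvector xs ys :
  exists f, is_eigenvector ([seq (false, x) | x <- xs] ++ [seq (true, y) | y <- ys]) f
    (\prod_(x <- xs) \prod_(y <- ys) ((1 - x * y) * (1 - q * (x * y))))
    (\prod_(x <- xs) \prod_(y <- ys) crossing_scale q x y * q^-1 ^+ (4 * size ys * size xs)).
Proof.
have gen l1 f c b : is_eigenvector (l1 ++ [seq (true, y) | y <- ys] ++ [seq (false, x) | x <- xs]) f c b ->
  exists f', is_eigenvector (l1 ++ [seq (false, x) | x <- xs] ++ [seq (true, y) | y <- ys]) f'
    (\prod_(x <- xs) \prod_(y <- ys) ((1 - x * y) * (1 - q * (x * y))) * c)
    (\prod_(x <- xs) \prod_(y <- ys) crossing_scale q x y * b).
  elim: xs l1 f c b => [|x xs IH] l1 f c b /=.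
    by rewrite cats0 => hf; exists f; rewrite !big_nil !mul1r.
  move=> /is_eigenvector_move[f1]; rewrite -cat_rcons => /IH[f2]; rewrite cat_rcons => hf2.
  by exists f2; move: hf2; rewrite !big_cons !mulrA ![(\prod_(x <- xs) _) * _]mulrC.
by have [f] := gen [::] _ _ _ (is_eigenvector_ground ys xs); rewrite mulr1; exists f.
Qed.

End Eigenvector.

(** * Turning a lattice upside down *)

(** The state of the [y] rows after the lattice is turned upside down: the rows are read in the
    opposite order and each letter [a] becomes [2 - a]. *)
Definition dual_word (J : seq nat) : seq nat := rev [seq (2 - a)%N | a <- J].

Lemma size_dual_word J : size (dual_word J) = size J.
Proof. by rewrite size_rev size_map. Qed.

Lemma dual_wordK n : {in words n, involutive dual_word}.
Proof.
move=> J; rewrite mem_words => /andP[_ hJ]; rewrite /dual_word map_rev revK -map_comp.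
by rewrite map_id_in // => a /(allP hJ) /= ha; rewrite subKn // -ltnS.
Qed.

Lemma dual_word_words n J : J \in words n -> dual_word J \in words n.
Proof.
rewrite !mem_words size_dual_word => /andP[-> hJ]; rewrite all_rev all_map.
by apply/allP => a _ /=; rewrite ltnS leq_subr.
Qed.

Lemma sum_words_dual (V : nmodType) n (g : seq nat -> V) :
  \sum_(J <- words n) g (dual_word J) = \sum_(J <- words n) g J.
Proof.
rewrite -(big_map dual_word xpredT g); apply: perm_big; apply: uniq_perm.
- by rewrite map_inj_in_uniq ?words_uniq //; apply: can_in_inj (@dual_wordK n).
- exact: words_uniq.
- move=> J; apply/mapP/idP => [[K hK ->]|hJ]; first exact: dual_word_words.
  by exists (dual_word J); rewrite ?dual_word_words // (dual_wordK hJ).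
Qed.

(** * Symmetries of a column *)

Section Columns.
Variables (F : fieldType) (P : Type).
Implicit Types (w : P -> nat -> nat -> nat -> nat -> F) (ps : seq P).

Lemma column_cat w ps1 ps2 i k J1 J2 L1 L2 :
  (i < 3)%N -> size J1 = size ps1 -> size L1 = size ps1 ->
  column w (ps1 ++ ps2) i k (J1 ++ J2) (L1 ++ L2) =
  \sum_(m < 3) column w ps1 i m J1 L1 * column w ps2 m k J2 L2.
Proof.
elim: ps1 i J1 L1 => [|p ps1 IH] i [|j J1] [|l L1] //= hi.
  rewrite (bigD1 (Ordinal hi)) //= eqxx mul1r big1 ?addr0 // => m.
  by rewrite -val_eqE /= eq_sym => /negPf ->; rewrite mul0r.
move=> [sJ] [sL]; under [RHS]eq_bigr do rewrite mulr_suml.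
rewrite [RHS]exchange_big; apply: eq_bigr => m _; rewrite IH // mulr_sumr.
by apply: eq_bigr => m' _; rewrite mulrA.
Qed.

Lemma column_rev w ps i k J L :
  (i < 3)%N -> (k < 3)%N -> size J = size ps -> size L = size ps ->
  column w ps i k J L =
  column (fun p i j k l => w p k j i l) (rev ps) k i (rev J) (rev L).
Proof.
elim: ps i J L => [|p ps IH] i [|j J] [|l L] //= hi hk; first by rewrite eq_sym.
move=> [sJ] [sL]; rewrite !rev_cons -!cats1 column_cat ?size_rev //.
apply: eq_bigr => m _; rewrite IH // mulrC; congr (_ * _) => /=.
rewrite (bigD1 (Ordinal hi)) //= eqxx mulr1 big1 ?addr0 // => n.
by rewrite -val_eqE /= => /negPf ->; rewrite mulr0.
Qed.

(** A gauge factor [g] on the vertical edges telescopes along the column. *)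
Lemma column_gauge w w' (c : nat -> F) (g : nat -> F) (s : P -> F) ps i k J L :
  (forall p i j k l, (i < 3)%N -> (j < 3)%N -> (k < 3)%N -> (l < 3)%N ->
    c j * w p i j k l * g i = g k * (s p * w' p i j k l)) ->
  (i < 3)%N -> J \in words (size ps) -> L \in words (size ps) ->
  \prod_(j <- J) c j * column w ps i k J L * g i =
  g k * (\prod_(p <- ps) s p * column w' ps i k J L).
Proof.
move=> H; elim: ps i J L => [|p ps IH] i [|j J] [|l L] hi; rewrite ?mem_words //=.
  move=> _ _; rewrite !big_nil !mul1r.
  by case: (altP (i =P k)) => [->|]; rewrite ?mulr1 ?mul1r ?mulr0 ?mul0r.
rewrite !eqSS => /and3P[sJ hj hJ] /and3P[sL hl hL].
rewrite !big_cons mulr_sumr mulr_suml !mulr_sumr; apply: eq_bigr => m _.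
transitivity (c j * w p i j m l * g i * (\prod_(j <- J) c j * column w ps m k J L)); first by ring.
rewrite H //.
transitivity (s p * w' p i j m l * (\prod_(j <- J) c j * column w ps m k J L * g m)).
  by ring.
by rewrite IH ?mem_words ?sJ ?sL //; ring.
Qed.

Lemma column_map w (h : nat -> nat) ps i k J L :
  column (fun p i j k l => w p i (h j) k (h l)) ps i k J L =
  column w ps i k (map h J) (map h L).
Proof. by elim: ps i J L => [|p ps IH] i [|j J] [|l L] //=; apply: eq_bigr => m _; rewrite IH. Qed.

Lemma column_rows (Q : Type) (h : Q -> P) w (ps : seq Q) i k J L :
  column (fun p => w (h p)) ps i k J L = column w (map h ps) i k J L.
Proof. by elim: ps i J L => [|p ps IH] i [|j J] [|l L] //=; apply: eq_bigr => m _; rewrite IH. Qed.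

Lemma column_scale w w' (s : P -> F) ps i k J L :
  (forall p i j k l, w p i j k l = s p * w' p i j k l) ->
  column w ps i k J L = \prod_(p <- ps) s p * column w' ps i k J L.
Proof.
move=> H; elim: ps i J L => [|p ps IH] i [|j J] [|l L] //=; rewrite ?mulr0 //.
  by rewrite big_nil mul1r.
rewrite mulr_sumr; apply: eq_bigr => m _; rewrite IH H big_cons; ring.
Qed.

Lemma column_conserve w ps i k J L :
  (forall p i j k l, w p i j k l != 0 -> (i + j = k + l)%N) ->
  column w ps i k J L != 0 -> (i + sumn J = k + sumn L)%N.
Proof.
move=> H; elim: ps i J L => [|p ps IH] i [|j J] [|l L] //=; rewrite ?eqxx //.
  by case: (altP (i =P k)) => [->|]; rewrite ?eqxx.
move=> /sum_neq0[m]; rewrite mulf_eq0 negb_or => /andP[/H h1 /IH h2]; lia.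
Qed.

End Columns.

(** * Crossing symmetry of the weights *)

Section Crossing.
Variable F : fieldType.
Variables (q : F).
Hypothesis (hq : q != 0) (hq1 : q != 1).
Implicit Types (x y z : F).

(** The vertex weight itself, the column parameter [z] being given first. *)
Definition ikweight z x (i j k l : nat) : F :=
  ikpoly q x z i j k l / ((x - q ^+ 2 * z) * (x - q ^+ 3 * z)).

Lemma ikweight_conserve c x i j k l : ikweight c x i j k l != 0 -> (i + j = k + l)%N.
Proof. by rewrite /ikweight mulf_eq0 negb_or => /andP[/ikpoly_conserve]. Qed.

Lemma ikweight_empty c x : (x - q ^+ 2 * c) * (x - q ^+ 3 * c) != 0 -> ikweight c x 0 0 0 0 = 1.
Proof. by move=> h; rewrite /ikweight /ikpoly divff. Qed.

Lemma dual_denominator y z : z != 0 ->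
  (y - q ^+ 2 * (q ^- 3 * z^-1)) * (y - q ^+ 3 * (q ^- 3 * z^-1)) =
  (1 - y * z) * (1 - q * (y * z)) / (q * z ^+ 2).
Proof. by move=> hz; field; rewrite hz hq. Qed.

(** The gauge factors of the vertical edges in the crossing symmetry. *)
Definition gauge (a : nat) : F :=
  match a with 0%N => 1 | 1%N => q - 1 | _ => - q end.

Lemma gauge_neq0 a : gauge a != 0.
Proof. by case: a => [|[|a]] /=; rewrite ?oner_eq0 ?subr_eq0 ?oppr_eq0. Qed.

Lemma ikpoly_scale c x y i j k l :
  ikpoly q (c * x) (c * y) i j k l = c ^+ 2 * ikpoly q x y i j k l.
Proof.
by move: i j k l => [|[|[|i]]] [|[|[|j]]] [|[|[|k]]] [|[|[|l]]];
  rewrite /ikpoly ?mulr0 //; ring.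
Qed.

(** Crossing symmetry in polynomial form: the vertex is turned upside down and its horizontal
    letters are complemented. *)
Lemma ikpoly_crossing s i j k l : (i < 3)%N -> (j < 3)%N -> (k < 3)%N -> (l < 3)%N ->
  q ^+ (2 * j) * ikpoly q (q ^+ 3 * s) 1 i j k l * gauge i =
  q ^+ 5 * (gauge k * ikpoly q 1 s k (2 - j) i (2 - l)).
Proof.
have [E|E] := eqVneq (i + j)%N (k + l)%N; last first.
  move=> hi hj hk hl.
  have -> : ikpoly q (q ^+ 3 * s) 1 i j k l = 0.
    by apply/eqP; apply: contraT => /ikpoly_conserve /eqP; rewrite (negPf E).
  have -> : ikpoly q 1 s k (2 - j) i (2 - l) = 0.
    by apply/eqP; apply: contraT => /ikpoly_conserve; lia.
  by rewrite !mulr0 mul0r.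
move: i j k l E => [|[|[|//]]] [|[|[|//]]] [|[|[|//]]] [|[|[|//]]] E _ _ _ _;
  try discriminate E; clear E.
all: by cbv beta iota zeta delta [ikpoly gauge subn subn_rec Nat.sub muln muln_rec Nat.mul Nat.add]; ring.
Qed.

Lemma ikweight_crossing y z i j k l : z != 0 ->
  (i < 3)%N -> (j < 3)%N -> (k < 3)%N -> (l < 3)%N ->
  q ^+ (2 * j) * ikweight (q ^- 3 * z^-1) y i j k l * gauge i =
  gauge k * (((1 - y * z) * (1 - q * (y * z)))^-1 * ikpoly q 1 (y * z) k (2 - j) i (2 - l)).
Proof.
move=> hz hi hj hk hl.
(* Homogeneity reduces the column parameter to 1. *)
pose c := q ^- 3 * z^-1.
have hc : c != 0 by rewrite mulf_neq0 ?invr_eq0 ?expf_neq0.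
rewrite /ikweight -/c.
have -> : ikpoly q y c i j k l = c ^+ 2 * ikpoly q (q ^+ 3 * (y * z)) 1 i j k l.
  by rewrite -ikpoly_scale mulr1; congr (ikpoly q _ _ _ _ _ _); rewrite /c; field; rewrite hz hq.
have -> : (y - q ^+ 2 * c) * (y - q ^+ 3 * c) = c ^+ 2 * q ^+ 5 * ((1 - y * z) * (1 - q * (y * z))).
  by rewrite /c; field; rewrite hz hq.
rewrite [(c ^+ 2 * q ^+ 5 * _)^-1]invfM.
set A := ((1 - y * z) * (1 - q * (y * z)))^-1.
have -> : (c ^+ 2 * q ^+ 5)^-1 = c ^- 2 * q ^- 5 by rewrite invfM.
transitivity (q ^+ (2 * j) * ikpoly q (q ^+ 3 * (y * z)) 1 i j k l * gauge i *
  ((c ^+ 2 * c ^- 2) * q ^- 5 * A)); first by ring.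
rewrite ikpoly_crossing // mulfV ?expf_neq0 // mul1r.
by rewrite mulrACA mulfV ?expf_neq0 // mul1r; ring.
Qed.

End Crossing.

(** * The fixed vector of the glued column *)

Section FixedVector.
Variable F : fieldType.
Variables (q e : F).
Hypothesis (hq : q != 0) (hq1 : q != 1) (he : e ^+ 2 = - (1 - q^-1) ^+ 2).
Implicit Types (x y z : F) (xs ys : seq F).

(** The entry, from the right states [(I, J)] to the left states [(I', J')], of a column of the
    two lattices with the letter [s] at its top. In a nonzero term, the sum of [J'] is the total
    of the letters of the string at this column and further right, so that over all the columns
    the powers of [q] multiply to the product of the [q^(2 k S_k)]. The gauge factor carries the
    rest of [(-1)^(|S|/2) c_S(q)]. *)
Definition pair_entry z xs ys (s : nat) (I' J' I J : seq nat) : F :=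
  q ^+ (2 * sumn J') * (gauge q s)^-1 * column (ikweight q z) xs 0 s I' I
    * column (ikweight q (q ^- 3 * z^-1)) ys 0 s J' J.

Lemma prod_exp_sumn c (J : seq nat) : \prod_(j <- J) q ^+ (c * j) = q ^+ (c * sumn J).
Proof.
elim: J => [|j J IH]; first by rewrite big_nil muln0.
by rewrite big_cons IH -exprD -mulnDr.
Qed.

Lemma column_dual z ys s J' J : z != 0 ->
  (forall y, y \in ys -> row_scale q z (true, y) != 0) -> (s < 3)%N ->
  J' \in words (size ys) -> J \in words (size ys) ->
  q ^+ (2 * sumn J') * column (ikweight q (q ^- 3 * z^-1)) ys 0 s J' J =
  gauge q s * ((\prod_(y <- ys) row_scale q z (true, y))^-1 *
    column (row_weight q z) [seq (true, y) | y <- rev ys] s 0 (dual_word J') (dual_word J)).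
Proof.
move=> hz hy hs hJ' hJ; rewrite -prodfV -prod_exp_sumn.
have := @column_gauge F F (ikweight q (q ^- 3 * z^-1)) 
  (fun y i j k l => ikpoly q 1 (y * z) k (2 - j) i (2 - l)) (fun j => q ^+ (2 * j)) (gauge q)
  (fun y => (row_scale q z (true, y))^-1) ys 0 s J' J.
rewrite mulr1 => -> //; last by move=> *; rewrite ikweight_crossing.
congr (_ * (_ * _)).
have sJ' : size J' = size ys by move: hJ'; rewrite mem_words => /andP[/eqP].
have sJ : size J = size ys by move: hJ; rewrite mem_words => /andP[/eqP].
rewrite (column_map (fun y i j k l => ikpoly q 1 (y * z) k j i l) (fun a => 2 - a)%N).
rewrite column_rev ?size_map // -column_rows.
by [].
Qed.

(** Summing over the letter [s] glues the two lattices: the column of the [y] rows, turned upside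
    down, continues the column of the [x] rows. *)
Lemma sum_pair_entry z xs ys I' J' I J : z != 0 ->
  (forall y, y \in ys -> row_scale q z (true, y) != 0) ->
  I' \in words (size xs) -> J' \in words (size ys) ->
  I \in words (size xs) -> J \in words (size ys) ->
  \sum_(s < 3) pair_entry z xs ys s I' J' I J =
  (\prod_(p <- [seq (false, x) | x <- xs] ++ [seq (true, y) | y <- rev ys]) row_scale q z p)^-1 *
  column (row_weight q z) ([seq (false, x) | x <- xs] ++ [seq (true, y) | y <- rev ys]) 0 0
     (I' ++ dual_word J') (I ++ dual_word J).
Proof.
move=> hz hy hI' hJ' hI hJ.
have sI' : size I' = size xs by move: hI'; rewrite mem_words => /andP[/eqP].
have sI : size I = size xs by move: hI; rewrite mem_words => /andP[/eqP].
rewrite column_cat ?size_map // mulr_sumr; apply: eq_bigr => s _.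
transitivity ((gauge q s)^-1 * column (ikweight q z) xs 0 s I' I *
  (q ^+ (2 * sumn J') * column (ikweight q (q ^- 3 * z^-1)) ys 0 s J' J)).
  by rewrite /pair_entry; ring.
rewrite column_dual //.
rewrite (@column_scale _ _ _ (fun x => row_weight q z (false, x))
  (fun x => (row_scale q z (false, x))^-1)) => [|x i j k l]; last exact: mulrC.
rewrite column_rows big_cat !big_map /= invfM prodfV.
have -> : \prod_(y <- rev ys) row_scale q z (true, y) = \prod_(y <- ys) row_scale q z (true, y).
  by apply: perm_big; rewrite perm_rev.
set A := (\prod_(x <- xs) _)^-1; set B := (\prod_(y <- ys) _)^-1.
set C := column _ _ _ _ _ _; set D := column _ _ _ _ _ _.
transitivity ((gauge q s)^-1 * gauge q s * (A * B * (C * D))); first by ring.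
by rewrite mulVf ?gauge_neq0 // mul1r.
Qed.

(** The fixed vector, as a function of the states [(I, J)], with its coefficient at the empty
    state and its pairing with the boundary vector. *)
Lemma exists_fixed_vector xs ys : exists phi : seq nat -> seq nat -> F,
  [/\ forall z I' J', z != 0 ->
        (forall y, y \in ys -> row_scale q z (true, y) != 0) ->
        (forall x, x \in xs -> row_scale q z (false, x) != 0) ->
        I' \in words (size xs) -> J' \in words (size ys) ->
        \sum_(I <- words (size xs)) \sum_(J <- words (size ys))
          \sum_(s < 3) pair_entry z xs ys s I' J' I J * phi I J = phi I' J',
      phi (nseq (size xs) 0%N) (nseq (size ys) 0%N) =
        \prod_(x <- xs) \prod_(y <- ys) ((1 - x * y) * (1 - q * (x * y))),
      \sum_(I <- words (size xs)) \sum_(J <- words (size ys))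
         boundary_weight q e 0 (I ++ dual_word J) * phi I J =
        \prod_(x <- xs) \prod_(y <- ys) crossing_scale q x y * q^-1 ^+ (4 * size ys * size xs)
    & forall I J, I \in words (size xs) -> J \in words (size ys) -> phi I J != 0 -> sumn I = sumn J].
Proof.
have [f [supp f0 fb eig]] := exists_eigenvector hq he xs (rev ys).
set ps := _ ++ _ in supp f0 fb eig.
have sps : size ps = (size xs + size ys)%N by rewrite size_cat !size_map size_rev.
have ground_ps : ground ps = nseq (size xs) 0%N ++ nseq (size ys) 2%N.
  have g b l : ground [seq (b, x) | x <- l] = nseq (size l) (if b then 2%N else 0%N).
    by elim: l => //= x l ->.
  by rewrite /ground map_cat -/ground -!/(ground _) !g size_rev.
have prod_rev (h : F -> F) : \prod_(y <- rev ys) h y = \prod_(y <- ys) h y.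
  by apply: perm_big; rewrite perm_rev.
exists (fun I J => f (I ++ dual_word J)); split.
- move=> z I' J' hz hy hx hI' hJ'.
  have hscale : \prod_(p <- ps) row_scale q z p != 0.
    rewrite big_cat !big_map /= mulf_neq0 // prodf_seq_neq0; apply/allP => u hu; apply/implyP => _.
      exact: hx.
    by apply: hy; rewrite -mem_rev.
  rewrite -[RHS]mul1r -(mulVf hscale) -mulrA -eig; last first.
    move: hI' (dual_word_words hJ'); rewrite !mem_words all_cat size_cat sps.
    by move=> /andP[/eqP-> ->] /andP[/eqP-> ->]; rewrite eqxx.
  rewrite /transfer sps sum_words_cat mulr_sumr; apply: eq_big_seq => I hI.
  rewrite -[in RHS]sum_words_dual mulr_sumr; apply: eq_big_seq => J hJ.
  by rewrite -mulr_suml sum_pair_entry // mulrA.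
- rewrite -(size_rev ys) (_ : _ ++ _ = ground ps) ?f0.
    by apply: eq_bigr => x _; exact: prod_rev.
  rewrite ground_ps size_rev; congr (_ ++ _).
  by rewrite /dual_word map_nseq -[RHS]revK rev_nseq rev_nseq.
- move: fb; rewrite /boundary_pairing sps sum_words_cat size_rev => fb.
  have hprod : \prod_(x <- xs) \prod_(y <- ys) crossing_scale q x y =
      \prod_(x <- xs) \prod_(y <- rev ys) crossing_scale q x y.
    by apply: eq_bigr => x _; rewrite prod_rev.
  rewrite hprod -fb; apply: eq_bigr => I _.
  by rewrite -[in RHS]sum_words_dual.
- move=> I J; rewrite !mem_words => /andP[/eqP sI hI] /andP[/eqP sJ hJ] /supp[+ _].
  rewrite ground_ps !sumn_cat !sumn_nseq mul0n add0n.
  have : (sumn (dual_word J) + sumn J = 2 * size J)%N.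
    rewrite /dual_word sumn_rev; elim: J hJ {sJ} => //= a J IH /andP[ha /IH]; lia.
  rewrite sJ; lia.
Qed.

End FixedVector.

(** * Products of triangular operators with small diagonal *)

Section Contraction.
Variables (F : numFieldType) (T : eqType) (st : seq T) (o : T) (rk : T -> nat).
Variable (E : nat -> nat -> T -> T -> F).

(** [E k s K' K] is the entry of the column [k] with letter [s], from the right state [K] to the
    left state [K']. The columns [k], [k + 1], ... with the letters of the word [s] are applied to
    [g]. *)
Fixpoint iterate (g : T -> F) (s : seq nat) (k : nat) (K' : T) : F :=
  if s is a :: s' then \sum_(K <- st) E k a K' K * iterate g s' k.+1 K else g K'.

Lemma eq_iterate g h s k K' : g =1 h -> iterate g s k K' = iterate h s k K'.
Proof.
move=> gh; elim: s k K' => [|a s IH] k K' /=; first exact: gh.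
by apply: eq_bigr => K _; rewrite IH.
Qed.

Lemma iterate_rcons g s a k K' :
  iterate g (rcons s a) k K' =
  iterate (fun K' => \sum_(K <- st) E (k + size s)%N a K' K * g K) s k K'.
Proof.
elim: s k K' => [|b s IH] k K' /=; first by rewrite addn0.
by apply: eq_bigr => K _; rewrite IH addSnnS.
Qed.

Lemma iterate_linear (c : F) g h s k K' :
  iterate (fun K => g K - c * h K) s k K' = iterate g s k K' - c * iterate h s k K'.
Proof.
elim: s k K' => [//|a s IH] k K' /=.
rewrite mulr_sumr -sumrB; apply: eq_bigr => K _; rewrite IH; ring.
Qed.

Lemma sum_iterate_fixed g :
  (forall k K', K' \in st -> \sum_(K <- st) \sum_(s < 3) E k s K' K * g K = g K') ->
  forall L k K', K' \in st -> \sum_(s <- words L) iterate g s k K' = g K'.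
Proof.
move=> H; elim=> [|L IH] k K' hK'; first by rewrite big_words0.
rewrite big_wordsS -[RHS](H k) // [RHS]exchange_big; apply: eq_bigr => a _ /=.
rewrite exchange_big; apply: eq_big_seq => K hK.
by rewrite -mulr_sumr IH.
Qed.

Hypothesis (uniq_st : uniq st) (o_st : o \in st).
Hypothesis E_rank : forall k s K' K, (s < 3)%N -> K' \in st -> K \in st ->
  E k s K' K != 0 -> K = K' \/ (rk K < rk K')%N.
Hypothesis E_ground : forall k s K, (s < 3)%N -> K \in st -> E k s o K != 0 -> K = o.
Variables (eps C : F).
Hypothesis (eps_ge0 : 0 <= eps) (eps_lt1 : eps < 1) (C_ge0 : 0 <= C).
Hypothesis E_diag : forall k K, K \in st -> K != o -> \sum_(s < 3) `|E k s K K| <= eps.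
Hypothesis E_bound : forall k s K' K, (s < 3)%N -> K' \in st -> K \in st -> `|E k s K' K| <= C.

(* The norm of [g] is the least [c] with [`|g K| <= c * wt K] for all [K]. The constant [kappa] is
   chosen so that the at most [size st] states below a given one, with three letters each, contribute
   at most [rho - eps]. *)
Let rho := (1 + eps) / 2.
Let kappa := 1 + 3 * C * (size st)%:R / (rho - eps).
Let wt K := kappa ^+ rk K.

Let rho_eps : rho - eps = (1 - eps) / 2.
Proof. by rewrite /rho; field. Qed.

Let gap_gt0 : 0 < rho - eps.
Proof. by rewrite rho_eps divr_gt0 ?subr_gt0 // ltr0n. Qed.

Let rho_ge0 : 0 <= rho.
Proof. by rewrite divr_ge0 ?addr_ge0 // ler0n. Qed.

Let kappa_ge1 : 1 <= kappa.
Proof. by rewrite lerDl divr_ge0 ?mulr_ge0 ?ler0n // ltW. Qed.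

Let kappa_gt0 : 0 < kappa. Proof. exact: lt_le_trans kappa_ge1. Qed.

Let wt_ge1 K : 1 <= wt K. Proof. exact: exprn_ege1. Qed.
Let wt_ge0 K : 0 <= wt K. Proof. exact: le_trans (wt_ge1 K). Qed.

Let wt_step K' K : (rk K < rk K')%N -> wt K <= wt K' / kappa.
Proof.
move=> h; rewrite ler_pdivlMr // /wt -exprSr.
by rewrite ler_weXn2l.
Qed.

(** On the states other than [o], each column contracts the weighted norm by [rho]: the diagonal
    contributes at most [eps], and the strictly lower states at most [rho - eps], because their
    weight is smaller by a factor [kappa]. *)
Lemma contraction_step k K' : K' \in st -> K' != o ->
  \sum_(K <- st | K != o) \sum_(s < 3) `|E k s K' K| * wt K <= rho * wt K'.
Proof.
move=> hK' ho.
apply: (@le_trans _ _ (\sum_(K <- st) ((K == K')%:R * eps * wt K' + 3 * C * (wt K' / kappa)))).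
  rewrite big_mkcond; apply: ler_sum_in => K hK _.
  have pos : 0 <= 3 * C * (wt K' / kappa) by rewrite !mulr_ge0 ?invr_ge0 ?ler0n // ltW.
  have [->|nK] := eqVneq K K'.
    by rewrite ho mul1r -mulr_suml ler_wpDr // ler_wpM2r // E_diag.
  rewrite !mul0r add0r; case: ifP => // _.
  have -> : 3 * C * (wt K' / kappa) = \sum_(s < 3) C * (wt K' / kappa).
    by rewrite sumr_const card_ord -[RHS]mulr_natl !mulrA.
  apply: ler_sum => s _.
  have [->|hE] := eqVneq (E k s K' K) 0; first by rewrite normr0 mul0r mulr_ge0 ?mulr_ge0 ?invr_ge0 // ltW.
  have [EK|hr] := E_rank (ltn_ord s) hK' hK hE; first by rewrite EK eqxx in nK.
  by rewrite ler_pM // ?E_bound // ?wt_step.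
rewrite big_split /= (bigD1_seq K') //= eqxx mul1r big1 => [|K /negPf->]; last by rewrite !mul0r.
have -> : \sum_(K <- st) 3 * C * (wt K' / kappa) = 3 * C * (wt K' / kappa) * (size st)%:R.
  by rewrite big_const_seq count_predT iter_addr_0 mulr_natr.
rewrite addr0.
rewrite -subr_ge0.
have -> : rho * wt K' - (eps * wt K' + 3 * C * (wt K' / kappa) * (size st)%:R) =
  (rho - eps) / kappa * wt K'.
  rewrite [in X in _ - X](_ : 3 * C * (wt K' / kappa) * (size st)%:R =
      (rho - eps) * (kappa - 1) * (wt K' / kappa)).
    by field; rewrite gt_eqF.
  rewrite /kappa [1 + _]addrC addrK [(rho - eps) * _]mulrC divfK ?gt_eqF //.
  by rewrite mulrAC.
by rewrite mulr_ge0 // divr_ge0 // ltW.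
Qed.

Lemma iterate_bound g c : 0 <= c -> g o = 0 -> (forall K, K \in st -> `|g K| <= c * wt K) ->
  forall L k K', K' \in st ->
    (K' = o -> forall s, s \in words L -> iterate g s k K' = 0) /\
    \sum_(s <- words L) `|iterate g s k K'| <= c * rho ^+ L * wt K'.
Proof.
move=> c0 go hg; elim=> [|L IH] k K' hK'.
  rewrite big_words0 expr0 mulr1; split; last exact: hg.
  by move=> -> s; rewrite mem_seq1 => /eqP ->.
have vanish : K' = o -> forall s, s \in words L.+1 -> iterate g s k K' = 0.
  move=> EK [|a s]; rewrite mem_words //= eqSS => /and3P[sL ha hs].
  rewrite big1_seq // => K /andP[_ hK].
  have [->|] := eqVneq (E k a K' K) 0; first by rewrite mul0r.
  rewrite {1}EK => /(E_ground ha hK) EKo; have [h _] := IH k.+1 K hK.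
  by rewrite h ?mulr0 // mem_words sL.
split=> //; have [EK|nK] := eqVneq K' o.
  have pos : 0 <= c * rho ^+ L.+1 * wt K'.
    by apply: mulr_ge0; [apply: mulr_ge0 => //; apply: exprn_ge0 | exact: wt_ge0].
  rewrite big1_seq // => s /andP[_ hs].
  by rewrite vanish ?normr0.
rewrite big_wordsS.
apply: (@le_trans _ _ (\sum_(a < 3) \sum_(K <- st | K != o) `|E k a K' K| * (c * rho ^+ L * wt K))).
  apply: ler_sum => a _ /=.
  apply: (@le_trans _ _ (\sum_(s <- words L) \sum_(K <- st | K != o) `|E k a K' K| * `|iterate g s k.+1 K|)).
    apply: ler_sum_in => s hs _; rewrite (bigID (fun K => K == o)) /= big1_seq ?add0r.
      by apply: le_trans (ler_norm_sum _ _ _) _; apply: ler_sum => K _; rewrite normrM.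
    by move=> K /andP[/eqP EK hK]; have [h _] := IH k.+1 K hK; rewrite h ?mulr0.
  rewrite exchange_big; apply: ler_sum_in => K hK _; rewrite -mulr_sumr ler_wpM2l //.
  by have [] := IH k.+1 K hK.
rewrite exchange_big /=.
have -> : c * rho ^+ L.+1 * wt K' = c * rho ^+ L * (rho * wt K') by rewrite exprSr; ring.
apply: le_trans (ler_wpM2l _ (contraction_step k hK' nK)); last by rewrite mulr_ge0 ?exprn_ge0.
rewrite mulr_sumr; apply: ler_sum => K _; rewrite mulr_sumr; apply: ler_sum => a _.
by rewrite mulrCA.
Qed.

Hypothesis E_ground0 : forall k s, (0 < s < 3)%N -> E k s o o = 0.
Variables (B phi : T -> F).
Hypothesis phi_fixed : forall k K', K' \in st ->
  \sum_(K <- st) \sum_(s < 3) E k s K' K * phi K = phi K'.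

Let delta K : F := (K == o)%:R.
Let t (s : seq nat) := \sum_(K <- st) B K * iterate delta s 0 K.

Let weighted (c : F) (g : T -> F) : 0 <= c -> (forall K, K \in st -> `|g K| <= c) ->
  forall K, K \in st -> `|g K| <= c * wt K.
Proof. by move=> c0 hg K /hg h; apply: le_trans h _; rewrite ler_peMr. Qed.

Let total_bound (c : F) (g : T -> F) L : 0 <= c -> g o = 0 -> (forall K, K \in st -> `|g K| <= c) ->
  \sum_(s <- words L) `|\sum_(K <- st) B K * iterate g s 0 K| <=
  c * (\sum_(K <- st) `|B K| * wt K) * rho ^+ L.
Proof.
move=> c0 go hg.
apply: (@le_trans _ _ (\sum_(s <- words L) \sum_(K <- st) `|B K| * `|iterate g s 0 K|)).
  apply: ler_sum => s _; apply: le_trans (ler_norm_sum _ _ _) _.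
  by apply: ler_sum => K _; rewrite normrM.
rewrite exchange_big mulrAC mulr_sumr; apply: ler_sum_in => K hK _.
rewrite -mulr_sumr [X in _ <= X]mulrCA ler_wpM2l //.
by have [_] := iterate_bound c0 go (weighted c0 hg) L 0 hK.
Qed.

(** The two estimates on the sums over words: convergence of the partial sums, from [phi = phi o *
    delta + psi] with [psi] vanishing at [o], and decay of the sum of the absolute values over the
    words with a given nonzero last letter. *)
Lemma series_estimates : exists r c : F, [/\ 0 <= r, r < 1, 0 <= c,
  forall L, `|phi o * \sum_(s <- words L) t s - \sum_(K <- st) B K * phi K| <= c * r ^+ L
  & forall L a, (0 < a < 3)%N -> \sum_(s <- words L) `|t (rcons s a)| <= c * r ^+ L].
Proof.
pose psi K := phi K - phi o * delta K.
pose cpsi := \sum_(K <- st) `|psi K|.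
pose cB := \sum_(K <- st) `|B K| * wt K.
have cpsi0 : 0 <= cpsi by apply: sumr_ge0.
have cB0 : 0 <= cB by apply: sumr_ge0 => K _; rewrite mulr_ge0.
have psio : psi o = 0 by rewrite /psi /delta eqxx mulr1 subrr.
have hpsi K : K \in st -> `|psi K| <= cpsi.
  move=> hK; rewrite /cpsi (bigD1_seq K) //= lerDl; exact: sumr_ge0.
exists rho, (cpsi * cB + C * cB); split.
- exact: rho_ge0.
- by rewrite /rho ltr_pdivrMr ?ltr0n // mul1r mulr2n ltrD2l.
- by rewrite addr_ge0 ?mulr_ge0.
- move=> L; apply: (@le_trans _ _ (cpsi * cB * rho ^+ L)); last first.
    by rewrite ler_wpM2r ?exprn_ge0 // lerDl mulr_ge0.
  rewrite distrC; apply: le_trans (total_bound L cpsi0 psio hpsi).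
  have -> : \sum_(K <- st) B K * phi K - phi o * \sum_(s <- words L) t s =
    \sum_(s <- words L) \sum_(K <- st) B K * iterate psi s 0 K.
    rewrite mulr_sumr [RHS]exchange_big /= /t.
    under [in X in _ - X]eq_bigr do rewrite mulr_sumr.
    rewrite [X in _ - X]exchange_big -sumrB; apply: eq_big_seq => K hK.
    rewrite -(sum_iterate_fixed phi_fixed L 0 hK) mulr_sumr -sumrB; apply: eq_bigr => s _.
    by rewrite iterate_linear; ring.
  exact: ler_norm_sum.
- move=> L a ha; apply: (@le_trans _ _ (C * cB * rho ^+ L)); last first.
    by rewrite ler_wpM2r ?exprn_ge0 // lerDr mulr_ge0.
  (* The last column, applied to the empty state, gives a vector which vanishes at [o]. *)
  pose g K' := E L a K' o.
  have go : g o = 0 by apply: E_ground0.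
  have hg K : K \in st -> `|g K| <= C by move=> hK; apply: E_bound => //; case/andP: ha.
  apply: le_trans (total_bound L C_ge0 go hg).
  apply: ler_sum_in => s hs _; rewrite [X in `|X| <= _](_ : t _ = \sum_(K <- st) B K * iterate g s 0 K) //.
  apply: eq_bigr => K _; congr (_ * _).
  rewrite iterate_rcons (_ : size s = L); last by move: hs; rewrite mem_words => /andP[/eqP].
  have gE K' : g K' = \sum_(K0 <- st) E (0 + L) a K' K0 * delta K0.
    rewrite (bigD1_seq o) //= /delta eqxx mulr1 big1 ?addr0 // => K0 /negPf->.
    by rewrite mulr0.
  by apply: eq_iterate => K1; rewrite gE.
Qed.

End Contraction.

(** * From edge labellings to words *)

Section FiniteFunctions.
Variable T : finType.

Definition ffun_cons n (t : T) (f : {ffun 'I_n -> T}) : {ffun 'I_n.+1 -> T} :=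
  [ffun i => if unlift ord0 i is Some j then f j else t].

Lemma ffun_cons0 n t (f : {ffun 'I_n -> T}) : ffun_cons t f ord0 = t.
Proof. by rewrite ffunE unlift_none. Qed.

Lemma ffun_consS n t (f : {ffun 'I_n -> T}) j : ffun_cons t f (lift ord0 j) = f j.
Proof. by rewrite ffunE liftK. Qed.

Lemma big_ffun_cons (V : nmodType) n (P : pred {ffun 'I_n.+1 -> T}) (G : {ffun 'I_n.+1 -> T} -> V) :
  \sum_(f | P f) G f = \sum_(t : T) \sum_(f : {ffun 'I_n -> T} | P (ffun_cons t f)) G (ffun_cons t f).
Proof.
rewrite pair_big_dep /= (reindex (fun p : T * {ffun 'I_n -> T} => ffun_cons p.1 p.2)) //=.
exists (fun f => (f ord0, [ffun j => f (lift ord0 j)])) => [[t f]|f] _ /=.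
  by rewrite ffun_cons0; congr pair; apply/ffunP => j; rewrite ffunE ffun_consS.
apply/ffunP => i; rewrite ffunE; case: unliftP => [j ->|->] //; by rewrite ffunE.
Qed.

End FiniteFunctions.

Section Paths.
Variables (F : fieldType) (T : finType).

(** The sum over the paths from [a] to [b], each step being weighted by the next function of the
    list. *)
Fixpoint chain (fs : seq (T -> T -> F)) (a b : T) : F :=
  if fs is f :: fs' then \sum_m f a m * chain fs' m b else (a == b)%:R.

Lemma sum_paths n (A : 'I_n -> T -> T -> F) a b :
  \sum_(u : {ffun 'I_n.+1 -> T} | (u ord0 == a) && (u ord_max == b))
    \prod_(r < n) A r (u (widen_ord (leqnSn n) r)) (u (lift ord0 r)) =
  chain [seq A r | r <- enum 'I_n] a b.
Proof.
elim: n A a => [|n IH] A a.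
  rewrite (_ : enum 'I_0 = [::]); last by apply/size0nil; rewrite size_enum_ord.
  rewrite big_ffun_cons /= (bigD1 a) //= [X in _ + X]big1 ?addr0; last first.
    move=> t /negPf ht; rewrite big1 // => f; rewrite ffun_cons0 ht //.
  have mE (f : {ffun 'I_0 -> T}) : ffun_cons a f ord_max = a.
    by rewrite (_ : ord_max = ord0) ?ffun_cons0 //; apply/val_inj.
  under eq_bigl do rewrite ffun_cons0 eqxx mE /=.
  case: (a == b); last by rewrite big_pred0_eq.
  under eq_bigr do rewrite big_ord0.
  by rewrite sumr_const card_ffun card_ord expn0.
rewrite enum_ordSl /= -map_comp big_ffun_cons (bigD1 a) //= [X in _ + X]big1 ?addr0; last first.
  by move=> t /negPf ht; rewrite big1 // => f; rewrite ffun_cons0 ht.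
have maxE (f : {ffun 'I_n.+1 -> T}) : ffun_cons a f ord_max = f ord_max.
  by rewrite -(ffun_consS a f); congr (ffun_cons a f _); apply/val_inj.
under eq_bigl do rewrite ffun_cons0 eqxx maxE /=.
rewrite (partition_big (fun f : {ffun 'I_n.+1 -> T} => f ord0) predT) //=.
apply: eq_bigr => m _; rewrite -(IH (fun r => A (lift ord0 r))) mulr_sumr.
apply: eq_big => [f|f /andP[_ /eqP fm]]; first by rewrite andbC.
rewrite big_ord_recl ffun_consS fm; congr (A _ _ _ * _).
  by rewrite (_ : widen_ord _ _ = ord0) ?ffun_cons0 //; apply/val_inj.
apply: eq_bigr => r _.
have -> : widen_ord (leqnSn n.+1) (lift ord0 r) = lift ord0 (widen_ord (leqnSn n) r) by apply/val_inj.
by rewrite !ffun_consS.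
Qed.

End Paths.

Lemma big_matrix_columns (V : nmodType) (T : finType) m n (P : pred 'M[T]_(m, n)) (G : 'M[T]_(m, n) -> V) :
  \sum_(v | P v) G v =
  \sum_(u : {ffun 'I_n -> {ffun 'I_m -> T}} | P (\matrix_(i, j) u j i)) G (\matrix_(i, j) u j i).
Proof.
rewrite (reindex (fun u : {ffun 'I_n -> {ffun 'I_m -> T}} => \matrix_(i, j) u j i)) //=.
exists (fun v : 'M[T]_(m, n) => [ffun j => [ffun i => v i j]]) => [u|v] _.
  by apply/ffunP => j; apply/ffunP => i; rewrite !ffunE mxE.
by apply/matrixP => i j; rewrite mxE !ffunE.
Qed.

Section Lattice.
Variable F : fieldType.

(** The sum over the vertical edges factors over the columns; the remaining sum over the
    horizontal edges is a sum over paths in the set of states. *)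
Lemma lattice_chain N L (W : 'I_N -> 'I_L -> nat -> nat -> nat -> nat -> F)
    (I : {ffun 'I_N -> 'I_3}) (S : two_string) :
  \sum_(hv : 'M['I_3]_(N, L.+1) * 'M['I_3]_(N.+1, L) | boundary_ok I S hv.1 hv.2)
    \prod_(r < N) \prod_(c < L)
      W r c (hv.2 (widen_ord (leqnSn N) r) c) (hv.1 r (widen_ord (leqnSn L) c))
        (hv.2 (lift ord0 r) c) (hv.1 r (lift ord0 c)) =
  chain [seq (fun h h' : {ffun 'I_N -> 'I_3} =>
      chain [seq (fun i k : 'I_3 => W r c i (h r) k (h' r)) | r <- enum 'I_N] ord0 (S c))
    | c <- enum 'I_L] I [ffun=> ord0].
Proof.
rewrite -sum_paths.
pose okh (h : 'M['I_3]_(N, L.+1)) := [forall r, h r ord0 == I r] && [forall r, h r ord_max == ord0].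
pose okv (v : 'M['I_3]_(N.+1, L)) := [forall c, v ord0 c == ord0] && [forall c, v ord_max c == S c].
rewrite (eq_bigl (fun hv => okh hv.1 && okv hv.2)); last first.
  by move=> hv; rewrite /boundary_ok /okh /okv !andbA.
rewrite -(pair_big okh okv (fun h v => \prod_(r < N) \prod_(c < L)
      W r c (v (widen_ord (leqnSn N) r) c) (h r (widen_ord (leqnSn L) c))
        (v (lift ord0 r) c) (h r (lift ord0 c)))) /=.
rewrite big_matrix_columns; apply: eq_big => [h|h _].
  rewrite /okh; congr (_ && _).
    by apply/forallP/eqP => [H|H r]; [apply/ffunP => r; have /eqP := H r; rewrite mxE | rewrite mxE H].
  apply/forallP/eqP => [H|H r]; last by rewrite mxE H ffunE.
  by apply/ffunP => r; have /eqP := H r; rewrite mxE ffunE.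
rewrite big_matrix_columns.
under [RHS]eq_bigr do rewrite -sum_paths.
rewrite bigA_distr_big_dep /=; apply: eq_big => [v|v _].
  rewrite /okv; apply/andP/familyP => [[/forallP H1 /forallP H2] c|H].
    by have := H1 c; have := H2 c; rewrite !mxE unfold_in => -> ->.
  by split; apply/forallP => c; have := H c; rewrite mxE unfold_in => /andP[].
rewrite exchange_big; apply: eq_bigr => c _; apply: eq_bigr => r _.
by rewrite !mxE.
Qed.

Definition word_of N (I : {ffun 'I_N -> 'I_3}) : seq nat := [seq nat_of_ord (I r) | r <- enum 'I_N].

Lemma word_of_cons N t (I : {ffun 'I_N -> 'I_3}) : word_of (ffun_cons t I) = nat_of_ord t :: word_of I.
Proof.
rewrite /word_of enum_ordSl /= ffun_cons0 -map_comp; congr (_ :: _).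
by apply: eq_map => r /=; rewrite ffun_consS.
Qed.

Lemma size_word_of N (I : {ffun 'I_N -> 'I_3}) : size (word_of I) = N.
Proof. by rewrite size_map size_enum_ord. Qed.

Lemma big_word_of (V : nmodType) N (G : seq nat -> V) :
  \sum_(I : {ffun 'I_N -> 'I_3}) G (word_of I) = \sum_(K <- words N) G K.
Proof.
elim: N G => [|N IH] G.
  rewrite big_words0 (eq_bigr (fun=> G [::])) => [|I _]; last first.
    by congr G; apply/size0nil; rewrite size_word_of.
  by rewrite sumr_const card_ffun !card_ord expn0.
rewrite big_wordsS big_ffun_cons; apply: eq_bigr => a _; rewrite -IH.
by apply: eq_bigr => I _; rewrite word_of_cons.
Qed.

Lemma word_of_inj N : injective (@word_of N).
Proof.
move=> I J /eq_in_map H; apply/ffunP => r; apply/val_inj/H.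
by rewrite mem_enum.
Qed.

Lemma word_of0 N : word_of ([ffun=> ord0] : {ffun 'I_N -> 'I_3}) = nseq N 0%N.
Proof.
rewrite /word_of -[N in RHS](size_enum_ord N).
by elim: (enum 'I_N) => //= r l ->; rewrite ffunE.
Qed.

Variable P : Type.
(** The partition function of the columns with the letters [s] at their tops, with state [K'] on
    the left and the empty state on the right; [w c] is the weight in the column [c]. *)
Fixpoint lattice (w : nat -> P -> nat -> nat -> nat -> nat -> F) (ps : seq P) (s K' : seq nat) : F :=
  if s is a :: s' then
    \sum_(K <- words (size ps)) column (w 0%N) ps 0 a K' K * lattice (fun c => w c.+1) ps s' K
  else (K' == nseq (size ps) 0%N)%:R.

Lemma column_chain N (w : P -> nat -> nat -> nat -> nat -> F) (X : 'I_N -> P)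
    (a b : 'I_3) (h h' : {ffun 'I_N -> 'I_3}) :
  chain [seq (fun i k : 'I_3 => w (X r) i (h r) k (h' r)) | r <- enum 'I_N] a b =
  column w [seq X r | r <- enum 'I_N] a b (word_of h) (word_of h').
Proof.
rewrite /word_of; elim: (enum 'I_N) a => [//|r l IH] a /=.
by apply: eq_bigr => m _; rewrite IH.
Qed.

Lemma lattice_sum N L (w : nat -> P -> nat -> nat -> nat -> nat -> F) (X : 'I_N -> P)
    (I : {ffun 'I_N -> 'I_3}) (S : two_string) :
  \sum_(hv : 'M['I_3]_(N, L.+1) * 'M['I_3]_(N.+1, L) | boundary_ok I S hv.1 hv.2)
    \prod_(r < N) \prod_(c < L)
      w c (X r) (hv.2 (widen_ord (leqnSn N) r) c) (hv.1 r (widen_ord (leqnSn L) c))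
        (hv.2 (lift ord0 r) c) (hv.1 r (lift ord0 c)) =
  lattice w [seq X r | r <- enum 'I_N] [seq nat_of_ord (S c) | c <- iota 0 L] (word_of I).
Proof.
rewrite (lattice_chain (fun r c => w c (X r))).
pose col c := fun h h' : {ffun 'I_N -> 'I_3} =>
  chain [seq (fun i k : 'I_3 => w c (X r) i (h r) k (h' r)) | r <- enum 'I_N] ord0 (S c).
have -> : [seq (fun h h' : {ffun 'I_N -> 'I_3} =>
      chain [seq (fun i k : 'I_3 => w c (X r) i (h r) k (h' r)) | r <- enum 'I_N] ord0 (S c))
    | c : 'I_L <- enum 'I_L] = [seq col c | c <- iota 0 L].
  by rewrite -val_enum_ord -map_comp.
have sX : size [seq X r | r <- enum 'I_N] = N by rewrite size_map size_enum_ord.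
have gen m w' : (forall c, w' c = w (m + c)%N) ->
    chain [seq col c | c <- iota m L] I [ffun=> ord0] =
    lattice w' [seq X r | r <- enum 'I_N] [seq nat_of_ord (S c) | c <- iota m L] (word_of I).
  elim: L m w' I => [|L' IH] m w' I' hw /=.
    by rewrite sX -word_of0 (inj_eq (@word_of_inj N)).
  rewrite sX -big_word_of; apply: eq_bigr => h _; rewrite /col column_chain hw addn0.
  by rewrite (IH m.+1 (fun c => w' c.+1)) // => c; rewrite hw addSnnS.
exact: gen.
Qed.

End Lattice.

(** * Triangularity of the column operator *)

(** The sum of the prefix sums of a word. *)
Fixpoint height (K : seq nat) : nat :=
  if K is a :: K' then (a * (size K').+1 + height K')%N else 0%N.

Lemma sumn_eq0 n K : K \in words n -> sumn K = 0%N -> K = nseq n 0%N.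
Proof.
rewrite mem_words => /andP[/eqP <- _]; elim: K => //= a K IH h.
by rewrite -IH; [congr (_ :: _)|]; lia.
Qed.

Section ColumnShape.
Variables (F : fieldType) (P : eqType) (w : P -> nat -> nat -> nat -> nat -> F).
Hypothesis w_conserve : forall p i j k l, w p i j k l != 0 -> (i + j = k + l)%N.

Lemma column_size ps i k J L : column w ps i k J L != 0 ->
  size J = size ps /\ size L = size ps.
Proof.
elim: ps i J L => [|p ps IH] i [|j J] [|l L] //=; rewrite ?eqxx //.
by move=> /sum_neq0[m]; rewrite mulf_eq0 negb_or => /andP[_ /IH[-> ->]].
Qed.

(** A column which is empty at its bottom moves weight upwards, so that the height does not
    increase from left to right, and it is constant only if the state does not change. For [i] not
    0, the incoming letter [i] counts once for each row. *)
Lemma column_height ps i k J L : column w ps i k J L != 0 ->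
  (height L <= i * size ps + height J)%N /\
  (height L = i * size ps + height J -> i = 0 -> J = L)%N.
Proof.
elim: ps i J L => [|p ps IH] i [|j J] [|l L] //=; rewrite ?eqxx //.
move=> /sum_neq0[m]; rewrite mulf_eq0 negb_or => /andP[/w_conserve h1 h2].
have [h3 h4] := IH _ _ _ h2; have [-> ->] := column_size h2.
have el : l = (i + j - m)%N by lia.
split; first by nia.
move=> E i0; have m0 : m = 0%N :> nat by nia.
have jl : j = l by lia.
rewrite jl; congr (_ :: _); apply: h4 => //; nia.
Qed.

Lemma column_diag ps J : size J = size ps ->
  column w ps 0 0 J J = \prod_(p <- zip ps J) w p.1 0 p.2 0 p.2.
Proof.
elim: ps J => [|p ps IH] [|j J] //=; first by rewrite big_nil.
move=> [sJ]; rewrite big_cons (bigD1 ord0) //= big1 ?addr0 ?IH // => m hm.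
rewrite (_ : w p 0 j m j = 0) ?mul0r //; apply/eqP; apply: contraT => /w_conserve.
by move: hm; rewrite -val_eqE /=; lia.
Qed.

Lemma column_zero_right ps i J : {in ps, forall p, w p 0 0 0 0 = 1} ->
  column w ps i 0 J (nseq (size ps) 0%N) = ((i == 0%N) && (J == nseq (size ps) 0%N))%:R.
Proof.
elim: ps i J => [|p ps IH] i [|j J] /= w1; rewrite ?andbF ?andbT //.
have w1' : {in ps, forall p, w p 0 0 0 0 = 1}.
  by move=> p' hp; apply: w1; rewrite inE hp orbT.
rewrite (bigD1 ord0) //= big1 ?addr0 => [|m]; last first.
  by rewrite -val_eqE /= IH // => /negPf->; rewrite mulr0.
rewrite IH // eqseq_cons /=; case: (altP (i =P 0%N)) => [->|hi] /=.
  case: (altP (j =P 0%N)) => [->|hj] /=; first by rewrite w1 ?mem_head ?mul1r.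
  rewrite (_ : w p 0 j 0 0 = 0) ?mul0r //; apply/eqP; apply: contraT => /w_conserve; lia.
rewrite (_ : w p i j 0 0 = 0) ?mul0r //; apply/eqP; apply: contraT => /w_conserve; lia.
Qed.

End ColumnShape.

(** * Diagonal entries: grouping the letters *)

Section Matching.
Variables (F : numFieldType) (eps : F).
Hypothesis eps_ge0 : 0 <= eps <= 1.
Implicit Types A B : seq F.

Let ge0 : pred F := fun a => 0 <= a.

(** The hypotheses on the diagonal factors: [A1], [A2] are those of the letters 1 and 2 on the [x]
    rows, [B1], [B2] on the [y] rows. A 1 can be grouped with a 1, a 2 with a 2, and a 2 with two
    1 in different positions. *)
Definition matchable A1 A2 B1 B2 : Prop :=
  [/\ [/\ all ge0 A1, all ge0 A2, all ge0 B1 & all ge0 B2],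
      forall a b, a \in A1 -> b \in B1 -> a * b <= eps,
      forall a b, a \in A2 -> b \in B2 -> a * b <= eps,
      forall a, a \in A2 -> pairwise (fun b b' => a * (b * b') <= eps) B1
    & forall b, b \in B2 -> pairwise (fun a a' => a * a' * b <= eps) A1].

Lemma matchable_sub A1 A2 B1 B2 A1' A2' B1' B2' :
  subseq A1' A1 -> subseq A2' A2 -> subseq B1' B1 -> subseq B2' B2 ->
  matchable A1 A2 B1 B2 -> matchable A1' A2' B1' B2'.
Proof.
move=> s1 s2 s3 s4 [[p1 p2 p3 p4] H11 H22 H12 H21].
have sub X Y : subseq X Y -> all ge0 Y -> all ge0 X.
  by move=> /mem_subseq h /allP g; apply/allP => u /h /g.
split; first by split; [exact: sub p1|exact: sub p2|exact: sub p3|exact: sub p4].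
- by move=> a b /(mem_subseq s1) ha /(mem_subseq s3) hb; exact: H11.
- by move=> a b /(mem_subseq s2) ha /(mem_subseq s4) hb; exact: H22.
- by move=> a /(mem_subseq s2) ha; apply: subseq_pairwise s3 (H12 a ha).
- by move=> b /(mem_subseq s4) hb; apply: subseq_pairwise s1 (H21 b hb).
Qed.

(** If the letters have the same sum on both sides, then they can be grouped completely: once
    equal letters have been paired, one side only has letters 2 and the other only letters 1. *)
Lemma matching_bound A1 A2 B1 B2 : matchable A1 A2 B1 B2 ->
  (size A1 + 2 * size A2 = size B1 + 2 * size B2)%N ->
  let total := \prod_(a <- A1) a * \prod_(a <- A2) a * (\prod_(b <- B1) b * \prod_(b <- B2) b) in
  total <= 1 /\ ((0 < size A1 + size A2)%N -> total <= eps).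
Proof.
have [e0 e1] := andP eps_ge0.
have [n] := ubnP (size A1 + size A2 + size B1 + size B2)%N.
have step (c t t' : F) (b : bool) : 0 <= c <= eps -> t' <= 1 -> t = c * t' -> t <= 1 /\ (b -> t <= eps).
  move=> /andP[c0 ce] h ->; have le : c * t' <= eps by apply: le_trans ce; rewrite ler_piMr.
  by split=> [|_] //; apply: le_trans e1.
elim: n A1 A2 B1 B2 => // n IH A1 A2 B1 B2 hn H hs /=.
have [[p1 p2 p3 p4] H11 H22 H12 H21] := H.
have red A1' A2' B1' B2' : subseq A1' A1 -> subseq A2' A2 -> subseq B1' B1 -> subseq B2' B2 ->
  (size A1' + size A2' + size B1' + size B2' < size A1 + size A2 + size B1 + size B2)%N ->
  (size A1' + 2 * size A2' = size B1' + 2 * size B2')%N ->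
  \prod_(a <- A1') a * \prod_(a <- A2') a * (\prod_(b <- B1') b * \prod_(b <- B2') b) <= 1.
  move=> s1 s2 s3 s4 hlt hs'.
  by have [] := IH A1' A2' B1' B2' (leq_trans hlt hn) (matchable_sub s1 s2 s3 s4 H) hs'.
have ss := @subseq_cons F.
case: A2 hn H hs p2 H22 H12 red => [|a2 A2] hn H hs p2 H22 H12 red.
  case: B2 hn H hs p4 H22 H21 red => [|b2 B2] hn H hs p4 H22 H21 red.
    case: A1 hn H hs p1 H11 H21 red => [|a A1] hn H hs p1 H11 H21 red.
      case: B1 hn H hs p3 H11 H12 red => [|b B1] // _ _ _ _ _ _ _.
      by rewrite !big_nil !mulr1.
    case: B1 hn H hs p3 H11 H12 red => [|b B1] // hn H hs p3 H11 H12 red.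
    have h := red A1 [::] B1 [::] (ss _ _) isT (ss _ _) isT.
    apply: (step (a * b) _ _ _ _ (h _ _)); rewrite /= ?addnS; try (move: hs; clear; rewrite /=; lia).
      by rewrite mulr_ge0 ?H11 ?mem_head //; [case/andP: p1 | case/andP: p3].
    by rewrite !big_cons !big_nil; ring.
  case: A1 hn H hs p1 H11 H21 red => [|a [|a' A1]] hn H hs p1 H11 H21 red;
    try by move: hs; clear; rewrite /=; lia.
  have h := red A1 [::] B1 B2 (subseq_trans (ss A1 a') (ss _ a)) isT (subseq_refl _) (ss _ _).
  apply: (step (a * a' * b2) _ _ _ _ (h _ _)); rewrite /=; try (move: hs; clear; rewrite /=; lia).
  + move: p1 p4 => /and3P[a0 a0' _] /andP[b0 _]; rewrite !mulr_ge0 //=.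
    by have /andP[/andP[]] := H21 b2 (mem_head _ _).
  + by rewrite !big_cons !big_nil; ring.
case: B2 hn H hs p4 H22 H21 red => [|b2 B2] hn H hs p4 H22 H21 red.
  case: B1 hn H hs p3 H11 H12 red => [|b [|b' B1]] hn H hs p3 H11 H12 red;
    try by move: hs; clear; rewrite /=; lia.
  have h := red A1 A2 B1 [::] (subseq_refl _) (ss _ _) (subseq_trans (ss B1 b') (ss _ b)) isT.
  apply: (step (a2 * (b * b')) _ _ _ _ (h _ _)); rewrite /=; try (move: hs; clear; rewrite /=; lia).
  + move: p2 p3 => /andP[a0 _] /and3P[b0 b0' _]; rewrite !mulr_ge0 //=.
    by have /andP[/andP[]] := H12 a2 (mem_head _ _).
  + by rewrite !big_cons !big_nil; ring.
have h := red A1 A2 B1 B2 (subseq_refl _) (ss _ _) (subseq_refl _) (ss _ _).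
apply: (step (a2 * b2) _ _ _ _ (h _ _)); rewrite /=; try (move: hs; clear; rewrite /=; lia).
  by rewrite mulr_ge0 ?H22 ?mem_head //; [case/andP: p2 | case/andP: p4].
by rewrite !big_cons; ring.
Qed.

End Matching.

(** * Uniform bounds on the weights *)

Section Bounded.
Variable F : numFieldType.
Implicit Types f g : nat -> F.

Definition bounded_seq f : Prop := exists C, forall k, `|f k| <= C.

Lemma bounded_const c : bounded_seq (fun=> c).
Proof. by exists `|c|. Qed.

Lemma boundedD f g : bounded_seq f -> bounded_seq g -> bounded_seq (fun k => f k + g k).
Proof.
move=> [C hC] [D hD]; exists (C + D) => k.
by apply: le_trans (ler_normD _ _) _; rewrite lerD.
Qed.

Lemma boundedM f g : bounded_seq f -> bounded_seq g -> bounded_seq (fun k => f k * g k).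
Proof. by move=> [C hC] [D hD]; exists (C * D) => k; rewrite normrM ler_pM. Qed.

Lemma bounded_norm f : bounded_seq f -> bounded_seq (fun k => `|f k|).
Proof. by move=> [C hC]; exists C => k; rewrite normr_id. Qed.

Lemma bounded_sum (I : Type) (r : seq I) (f : I -> nat -> F) :
  (forall i, bounded_seq (f i)) -> bounded_seq (fun k => \sum_(i <- r) f i k).
Proof.
move=> H; elim: r => [|i r [C hC]].
  by exists 0 => k; rewrite big_nil normr0.
have [D hD] := H i; exists (D + C) => k.
by rewrite big_cons; apply: le_trans (ler_normD _ _) _; rewrite lerD.
Qed.

Lemma eq_bounded f g : f =1 g -> bounded_seq f -> bounded_seq g.
Proof. by move=> fg [C hC]; exists C => k; rewrite -fg. Qed.

Lemma bounded_column (P : eqType) (w : nat -> P -> nat -> nat -> nat -> nat -> F) ps i k J L :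
  (forall p i j k l, p \in ps -> bounded_seq (fun c => w c p i j k l)) ->
  bounded_seq (fun c => column (w c) ps i k J L).
Proof.
elim: ps i J L => [|p ps IH] i [|j J] [|l L] /= H; try exact: bounded_const.
apply: bounded_sum => m; apply: boundedM; first by apply: H; rewrite mem_head.
by apply: IH => p' *; apply: H; rewrite inE orbC; apply/orP; left.
Qed.

Variable q : F.

(** The condition that the poles are avoided uniformly, with the bound in the field of the
    parameters. *)
Definition off_poles x (z : nat -> F) : Prop :=
  exists2 d : F, 0 < d & forall k,
    d * (`|x| + `|z k|) <= `|x - q ^+ 2 * z k| /\ d * (`|x| + `|z k|) <= `|x - q ^+ 3 * z k|.

Lemma ikpoly_quadratic x y i j k l : ikpoly q x y i j k l =
  ikpoly q 1 0 i j k l * (x * x) +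
  (ikpoly q 1 1 i j k l - ikpoly q 1 0 i j k l - ikpoly q 0 1 i j k l) * (x * y)
  + ikpoly q 0 1 i j k l * (y * y).
Proof.
by move: i j k l => [|[|[|i]]] [|[|[|j]]] [|[|[|k]]] [|[|[|l]]];
  cbv beta iota zeta delta [ikpoly]; ring.
Qed.

(** Each weight is a quadratic polynomial in the ratios of [x] and [z c] to the denominators, and
    these ratios are bounded. *)
Lemma bounded_ikweight x z i j k l : off_poles x z ->
  bounded_seq (fun c => ikweight q (z c) x i j k l).
Proof.
move=> [d d0 H].
have ratio (u v : nat -> F) : (forall c, d * `|u c| <= `|v c|) -> bounded_seq (fun c => u c / v c).
  move=> h; exists d^-1 => c; rewrite normrM normfV.
  have [->|nv] := eqVneq (v c) 0; first by rewrite normr0 invr0 mulr0 invr_ge0 ltW.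
  by rewrite ler_pdivrMr ?normr_gt0 // ler_pdivlMl.
have le c : d * `|x| <= d * (`|x| + `|z c|) /\ d * `|z c| <= d * (`|x| + `|z c|).
  by rewrite !ler_wpM2l ?lerDl ?lerDr // ltW.
have bx2 : bounded_seq (fun c => x / (x - q ^+ 2 * z c)).
  by apply: (ratio (fun=> x)) => c; have [h _] := H c; have [h' _] := le c; apply: le_trans h.
have bz2 : bounded_seq (fun c => z c / (x - q ^+ 2 * z c)).
  by apply: ratio => c; have [h _] := H c; have [_ h'] := le c; apply: le_trans h.
have bx3 : bounded_seq (fun c => x / (x - q ^+ 3 * z c)).
  by apply: (ratio (fun=> x)) => c; have [_ h] := H c; have [h' _] := le c; apply: le_trans h.
have bz3 : bounded_seq (fun c => z c / (x - q ^+ 3 * z c)).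
  by apply: ratio => c; have [_ h] := H c; have [_ h'] := le c; apply: le_trans h.
pose c1 := ikpoly q 1 0 i j k l; pose c3 := ikpoly q 0 1 i j k l.
pose c2 := ikpoly q 1 1 i j k l - c1 - c3.
apply: (@eq_bounded (fun c => c1 * (x / (x - q ^+ 2 * z c) * (x / (x - q ^+ 3 * z c)))
  + c2 * (x / (x - q ^+ 2 * z c) * (z c / (x - q ^+ 3 * z c)))
  + c3 * (z c / (x - q ^+ 2 * z c) * (z c / (x - q ^+ 3 * z c))))).
  by move=> c; rewrite /ikweight ikpoly_quadratic invfM -/c1 -/c3 -/c2; ring.
by apply: boundedD; [apply: boundedD|]; (apply: boundedM; [exact: bounded_const | exact: boundedM]).
Qed.

Lemma off_poles_neq0 x z k : z k != 0 -> off_poles x z ->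
  (x - q ^+ 2 * z k) * (x - q ^+ 3 * z k) != 0.
Proof.
move=> hz [d d0 H]; have pos : 0 < d * (`|x| + `|z k|).
  by rewrite mulr_gt0 // ltr_wpDl // normr_gt0.
by have [h2 h3] := H k; rewrite mulf_neq0 // -normr_gt0 (lt_le_trans pos).
Qed.

End Bounded.

(** * Partial sums over the strings of bounded length *)

Section Estimates.
Variable F : numFieldType.
Variables (q e : F).
Hypothesis (hq : q != 0) (hq1 : q != 1) (he : e ^+ 2 = - (1 - q^-1) ^+ 2).
Variables (xs ys : seq F) (z : nat -> F) (eps : F).
Hypothesis (hz : forall k, z k != 0).
Let z' k := q ^- 3 * (z k)^-1.
Hypothesis hxz : forall x, x \in xs -> off_poles q x z.
Hypothesis hyz : forall y, y \in ys -> off_poles q y z'.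
Let u k x a := `|ikweight q (z k) x 0 a 0 a|.
Let v k y b := `|q ^+ (2 * b) * ikweight q (z' k) y 0 b 0 b|.
Hypothesis (eps_ge0 : 0 <= eps) (eps_lt1 : eps < 1).
Hypothesis h11 : forall k x y, x \in xs -> y \in ys -> u k x 1 * v k y 1 <= eps.
Hypothesis h22 : forall k x y, x \in xs -> y \in ys -> u k x 2 * v k y 2 <= eps.
Hypothesis h12 : forall k x, x \in xs -> pairwise (fun y y' => u k x 2 * (v k y 1 * v k y' 1) <= eps) ys.
Hypothesis h21 : forall k y, y \in ys -> pairwise (fun x x' => u k x 1 * u k x' 1 * v k y 2 <= eps) xs.

Let z'_neq0 k : z' k != 0.
Proof. by rewrite mulf_neq0 ?invr_eq0 ?expf_neq0. Qed.

Lemma row_scale_dual_neq0 k y : y \in ys -> row_scale q (z k) (true, y) != 0.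
Proof.
move=> /hyz /(off_poles_neq0 (z'_neq0 k)); apply: contraNneq; rewrite /row_scale /= => h.
by rewrite dual_denominator // h mul0r.
Qed.

Lemma diag_prod k I J : size I = size xs -> size J = size ys ->
  `|pair_entry q (z k) xs ys 0 I J I J| =
  \prod_(p <- zip xs I) u k p.1 p.2 * \prod_(p <- zip ys J) v k p.1 p.2.
Proof.
move=> sI sJ; rewrite /pair_entry invr1 mulr1.
rewrite (column_diag (@ikweight_conserve _ q (z k))) // (column_diag (@ikweight_conserve _ q (z' k))) //.
rewrite mulrAC normrM mulrC normr_prod; congr (_ * _).
rewrite -prod_exp_sumn (_ : \prod_(j <- J) _ = \prod_(p <- zip ys J) q ^+ (2 * p.2)).
  by rewrite -big_split normr_prod.
by rewrite -(big_map snd xpredT (fun j => q ^+ (2 * j))) -/unzip2 unzip2_zip // sJ.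
Qed.

Let zip_split (G : F -> nat -> F) (ps : seq F) (J : seq nat) : size J = size ps ->
  all (fun a => a < 3)%N J -> {in ps, forall p, G p 0%N = 1} ->
  \prod_(p <- zip ps J) G p.1 p.2 =
    \prod_(a <- [seq G p.1 1%N | p <- zip ps J & p.2 == 1%N]) a *
    \prod_(a <- [seq G p.1 2%N | p <- zip ps J & p.2 == 2%N]) a /\
  (size [seq G p.1 1%N | p <- zip ps J & p.2 == 1%N] +
    2 * size [seq G p.1 2%N | p <- zip ps J & p.2 == 2%N] = sumn J)%N.
Proof.
elim: ps J => [|p ps IH] [|j J] //=; first by rewrite !big_nil mulr1.
move=> [sJ] /andP[hj hJ] G0.
have [h1 h2] := IH J sJ hJ (fun p' hp => G0 p' (@mem_behead _ (p :: ps) p' hp)).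
case: j hj => [|[|[|]]] //= _; rewrite !big_cons h1 -h2 ?G0 ?mem_head ?mul1r /=; split=> //; try lia.
- by rewrite mulrA.
- by rewrite mulrCA.
Qed.

(** The diagonal entries of the column operator, away from the empty state. *)
Lemma diag_bound k I J : I \in words (size xs) -> J \in words (size ys) ->
  sumn I = sumn J -> (0 < sumn I)%N -> \sum_(s < 3) `|pair_entry q (z k) xs ys s I J I J| <= eps.
Proof.
rewrite !mem_words => /andP[/eqP sI hI] /andP[/eqP sJ hJ] hIJ hpos.
rewrite (bigD1 ord0) //= big1 ?addr0 => [|s hs]; last first.
  rewrite /pair_entry (_ : column _ xs _ _ _ _ = 0) ?mulr0 ?mul0r ?normr0 //.
  apply/eqP; apply: contraT => /(column_conserve (@ikweight_conserve _ q (z k))).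
  by move: hs; rewrite -val_eqE /=; lia.
rewrite diag_prod //.
have u0 x : x \in xs -> u k x 0 = 1.
  by move=> /hxz /(off_poles_neq0 (hz k)) h; rewrite /u ikweight_empty ?normr1.
have v0 y : y \in ys -> v k y 0 = 1.
  by move=> /hyz /(off_poles_neq0 (z'_neq0 k)) h; rewrite /v muln0 mul1r ikweight_empty ?normr1.
have [Ex sx] := zip_split sI hI u0; have [Ey sy] := zip_split sJ hJ v0.
have eps_le1 : 0 <= eps <= 1 by rewrite eps_ge0 ltW.
have zx p c : p \in [seq p <- zip xs I | p.2 == c] -> p.1 \in xs.
  by rewrite mem_filter => /andP[_ hp]; rewrite -(@unzip1_zip _ _ xs I) ?sI ?map_f.
have zy p c : p \in [seq p <- zip ys J | p.2 == c] -> p.1 \in ys.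
  by rewrite mem_filter => /andP[_ hp]; rewrite -(@unzip1_zip _ _ ys J) ?sJ ?map_f.
have pw (r : rel F) (G : F -> F) (ps : seq F) (K : seq nat) c : size K = size ps ->
    pairwise (fun y y' => r (G y) (G y')) ps -> pairwise r [seq G p.1 | p <- zip ps K & p.2 == c].
  move=> sK h; rewrite pairwise_map; apply: subseq_pairwise (filter_subseq _ _) _.
  by move: h; rewrite -{1}(@unzip1_zip _ _ ps K) ?sK // pairwise_map.
have norm_ge0 (G : F * nat -> F) ps : all (fun a => 0 <= a) [seq `|G p| | p <- ps].
  by rewrite all_map; apply/allP => p _ /=.
have [|_ bound] := @matching_bound _ _ eps_le1 [seq u k p.1 1 | p <- zip xs I & p.2 == 1%N]
  [seq u k p.1 2 | p <- zip xs I & p.2 == 2%N] [seq v k p.1 1 | p <- zip ys J & p.2 == 1%N]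
  [seq v k p.1 2 | p <- zip ys J & p.2 == 2%N] _ (etrans sx (etrans hIJ (esym sy))); last first.
  rewrite Ex Ey; apply: bound; rewrite lt0n addn_eq0; apply: contraTN hpos => /andP[/eqP a1 /eqP a2].
  by rewrite -sx a1 a2.
split; first by split; apply: norm_ge0.
- by move=> _ _ /mapP[p /zx hp ->] /mapP[p' /zy hp' ->]; exact: h11.
- by move=> _ _ /mapP[p /zx hp ->] /mapP[p' /zy hp' ->]; exact: h22.
- move=> _ /mapP[p /zx hp ->].
  by apply: (pw (fun b b' => u k p.1 2 * (b * b') <= eps) (fun y => v k y 1)) => //; exact: h12.
- move=> _ /mapP[p /zy hp ->].
  by apply: (pw (fun a a' => a * a' * v k p.1 2 <= eps) (fun x => u k x 1)) => //; exact: h21.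
Qed.

(** The pairs of states of the same weight, one on the [x] rows and one on the [y] rows; only
    these contribute to the sum. *)
Definition pair_states : seq (seq nat * seq nat) :=
  [seq K <- [seq (K1, K2) | K1 <- words (size xs), K2 <- words (size ys)] | sumn K.1 == sumn K.2].

Definition ground_pair : seq nat * seq nat := (nseq (size xs) 0%N, nseq (size ys) 0%N).

Definition string_entry k a (K' K : seq nat * seq nat) : F :=
  pair_entry q (z k) xs ys a K'.1 K'.2 K.1 K.2.

Lemma mem_pair_states K : (K \in pair_states) =
  [&& sumn K.1 == sumn K.2, K.1 \in words (size xs) & K.2 \in words (size ys)].
Proof.
rewrite mem_filter; congr (_ && _); apply/allpairsP/andP => [[[I J] [? ? ->]]//|[h1 h2]].
by exists K; split=> //; case: K {h1 h2}.
Qed.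

Lemma uniq_pair_states : uniq pair_states.
Proof.
apply/filter_uniq/allpairs_uniq; rewrite ?words_uniq //.
by move=> [I J] [I' J'] _ _ [-> ->].
Qed.

Lemma ground_pair_mem : ground_pair \in pair_states.
Proof. by rewrite mem_pair_states /= !mem_words !sumn_nseq !size_nseq !all_nseq !eqxx !orbT. Qed.

Lemma sum_pair_states (G : seq nat -> seq nat -> F) :
  (forall I J, I \in words (size xs) -> J \in words (size ys) -> G I J != 0 -> sumn I = sumn J) ->
  \sum_(K <- pair_states) G K.1 K.2 =
  \sum_(I <- words (size xs)) \sum_(J <- words (size ys)) G I J.
Proof.
move=> H; rewrite big_filter big_mkcond big_allpairs_dep /=.
apply: eq_big_seq => I hI; apply: eq_big_seq => J hJ /=.
by case: eqP => // h; apply/esym/eqP; apply: contraT => /(H I J hI hJ).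
Qed.

Lemma string_entry_neq0 k a K' K : string_entry k a K' K != 0 ->
  [/\ sumn K'.1 = (a + sumn K.1)%N, sumn K'.2 = (a + sumn K.2)%N,
      height K.1 <= height K'.1 /\ height K.2 <= height K'.2,
      height K.1 = height K'.1 -> K'.1 = K.1 & height K.2 = height K'.2 -> K'.2 = K.2]%N.
Proof.
rewrite /string_entry /pair_entry !mulf_eq0 !negb_or => /andP[/andP[_ hx] hy].
have cx := column_conserve (@ikweight_conserve _ q (z k)) hx.
have cy := column_conserve (@ikweight_conserve _ q (z' k)) hy.
have [lx ex] := column_height (@ikweight_conserve _ q (z k)) hx.
have [ly ey] := column_height (@ikweight_conserve _ q (z' k)) hy.
by split=> // [h|h]; [apply: ex | apply: ey].
Qed.

Lemma bounded_string_entry : exists2 C : F, 0 <= C &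
  forall k s K' K, (s < 3)%N -> K' \in pair_states -> K \in pair_states ->
    `|string_entry k s K' K| <= C.
Proof.
have [C hC] : bounded_seq (fun k => \sum_(K' <- pair_states) \sum_(K <- pair_states)
    \sum_(s <- iota 0 3) `|string_entry k s K' K|).
  apply: bounded_sum => K'; apply: bounded_sum => K; apply: bounded_sum => s.
  apply: bounded_norm; apply: boundedM.
    apply: boundedM; first exact: bounded_const.
    by apply: bounded_column => x *; apply: bounded_ikweight; exact: hxz.
  by apply: bounded_column => y *; apply: (@bounded_ikweight _ _ _ z'); exact: hyz.
exists C => [|k s K' K hs hK' hK]; first exact: le_trans (hC 0%N).
have le_sum (T : eqType) (r : seq T) (f : T -> F) i : i \in r -> (forall i, 0 <= f i) ->
    f i <= \sum_(i <- r) f i.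
  elim: r => // a r IH; rewrite inE big_cons => /predU1P[->|hi] f0; first by rewrite lerDl sumr_ge0.
  by rewrite ler_wpDl // IH.
have := hC k; rewrite ger0_norm; last by do 3!apply: sumr_ge0 => ? _.
apply: le_trans.
apply: le_trans (le_sum _ _ _ K' hK' _) => [|?]; last by do 2!apply: sumr_ge0 => ? _.
apply: le_trans (le_sum _ _ _ K hK _) => [|?]; last by apply: sumr_ge0 => ? _.
by apply: (le_sum _ _ (fun s => `|string_entry k s K' K|)) => //; rewrite mem_iota.
Qed.

Let t s := \sum_(K <- pair_states) boundary_weight q e 0 (K.1 ++ dual_word K.2) *
  iterate pair_states string_entry (fun K => (K == ground_pair)%:R) s 0 K.

(** The estimates for the strings of length at most [L]: [t s] is the term of the string with the
    letters [s], up to the factor [q^(4 M N)]. *)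
Lemma string_estimates : exists r c : F, [/\ 0 <= r, r < 1, 0 <= c,
  forall L, `|\prod_(x <- xs) \prod_(y <- ys) ((1 - x * y) * (1 - q * (x * y))) * \sum_(s <- words L) t s -
     \prod_(x <- xs) \prod_(y <- ys) crossing_scale q x y * q^-1 ^+ (4 * size ys * size xs)| <= c * r ^+ L
  & forall L a, (0 < a < 3)%N -> \sum_(s <- words L) `|t (rcons s a)| <= c * r ^+ L].
Proof.
have [phi [fixed phi0 pairing supp]] := exists_fixed_vector hq hq1 he xs ys.
have [C C0 hC] := bounded_string_entry.
have [] := @series_estimates F _ pair_states ground_pair (fun K => height K.1 + height K.2)%N
  string_entry uniq_pair_states ground_pair_mem _ _ eps C eps_ge0 eps_lt1 C0 _ hC _
  (fun K => boundary_weight q e 0 (K.1 ++ dual_word K.2)) (fun K => phi K.1 K.2) _.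
- move=> k s K' K _ _ _ /string_entry_neq0[_ _ [l1 l2] e1 e2].
  have [h1|h1] := eqVneq (height K.1) (height K'.1); last first.
    by right; rewrite -addSn leq_add // ltn_neqAle h1.
  have [h2|h2] := eqVneq (height K.2) (height K'.2); last first.
    by right; rewrite -addnS leq_add // ltn_neqAle h2.
  by left; case: K K' e1 e2 h1 h2 {l1 l2} => [I J] [I' J'] /= e1 e2 /e1-> /e2->.
- move=> k s K _; rewrite mem_pair_states => /and3P[_ h1 h2] /string_entry_neq0[].
  rewrite /= !sumn_nseq => s1 s2 _ _ _; case: K h1 h2 s1 s2 => I J /= h1 h2 s1 s2.
  by rewrite /ground_pair -(sumn_eq0 h1) -?(sumn_eq0 h2) //; lia.
- move=> k K; rewrite mem_pair_states => /and3P[/eqP hs h1 h2] hK.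
  apply: diag_bound => //; rewrite lt0n; apply: contra hK => /eqP s0.
  rewrite /ground_pair -(sumn_eq0 h1 s0) -(sumn_eq0 h2) -?hs //.
  by case: (K).
- move=> k s /andP[s0 _]; apply/eqP; apply: contraT => /string_entry_neq0[].
  by rewrite /= sumn_nseq; lia.
- move=> k K'; rewrite mem_pair_states => /and3P[/eqP hs h1 h2].
  rewrite (@sum_pair_states (fun I J => \sum_(s < 3) string_entry k s K' (I, J) * phi I J)).
    apply: fixed => // [y|x]; first exact: row_scale_dual_neq0.
    by move=> /hxz /(off_poles_neq0 (hz k)).
  move=> I J hI hJ; have [->|/(supp I J hI hJ) //] := eqVneq (phi I J) 0.
  by rewrite big1 ?eqxx // => s _; rewrite mulr0.
move=> r [c []]; rewrite phi0.
rewrite (@sum_pair_states (fun I J => boundary_weight q e 0 (I ++ dual_word J) * phi I J)); last first.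
  move=> I J hI hJ; have [->|/(supp I J hI hJ) //] := eqVneq (phi I J) 0.
  by rewrite mulr0 eqxx.
by rewrite pairing => r0 r1 c0 H1 H2; exists r, c.
Qed.

End Estimates.

(** * The boundary weight of a glued state *)

Section BoundaryWeight.
Variables (F : fieldType) (q e : F).
Implicit Types I J K : seq nat.

Lemma boundary_weight_cat s I K :
  boundary_weight q e s (I ++ K) = boundary_weight q e s I * boundary_weight q e (s + sumn I) K.
Proof.
elim: I s => [|a I IH] s /=; first by rewrite mul1r addn0.
by rewrite IH mulrA addnA.
Qed.

Lemma boundary_weight_shift s K :
  boundary_weight q e s K = q^-1 ^+ (s * sumn [seq (2 - a)%N | a <- K]) * boundary_weight q e 0 K.
Proof.
elim: K s => [|a K IH] s /=; first by rewrite muln0 mulr1.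
rewrite IH [in RHS]IH /boundary_factor mul0n expr0 mulr1 mulnDr mulnDl !exprD; ring.
Qed.

(** The numbers of letters 1 and of inversions do not change when a word is reversed and its
    letters are complemented. *)
Lemma boundary_weight_dual n J : J \in words n ->
  boundary_weight q e 0 (dual_word J) = boundary_weight q e 0 J.
Proof.
rewrite mem_words => /andP[_]; elim: J {n} => //= a J IH /andP[ha hJ].
rewrite /dual_word /= rev_cons -cats1 boundary_weight_cat -/(dual_word J) IH //=.
rewrite [in RHS]boundary_weight_shift mulr1 !add0n sumn_rev /boundary_factor mul0n subKn -1?ltnS //.
rewrite (_ : ((2 - a)%N == 1%N) = (a == 1%N)); last by case: a ha => [|[|[|]]].
by rewrite [(sumn _ * a)%N]mulnC; ring.
Qed.

(** The cross terms of the inversion number give the factor [q^(- |S|^2)], as both states have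
    weight [|S|]. *)
Lemma boundary_weight_pair n m I J : I \in words n -> J \in words m ->
  boundary_weight q e 0 (I ++ dual_word J) =
  boundary_weight q e 0 I * boundary_weight q e 0 J * q^-1 ^+ (sumn I * sumn J).
Proof.
move=> hI hJ; rewrite boundary_weight_cat add0n [X in _ * X]boundary_weight_shift (boundary_weight_dual hJ).
rewrite /dual_word map_rev sumn_rev -map_comp (_ : [seq _ | a <- J] = J).
  by rewrite mulrA mulrAC.
move: hJ; rewrite mem_words => /andP[_ hJ].
by rewrite map_id_in // => a /(allP hJ) /= ha; rewrite subKn // -ltnS.
Qed.

Lemma boundary_weight_enum N (f : 'I_N -> nat) s :
  boundary_weight q e s [seq f r | r <- enum 'I_N] =
  e ^+ (\sum_(r < N) (f r == 1%N)) *
  q^-1 ^+ (s * \sum_(r < N) (2 - f r) + \sum_(i < N) \sum_(j < N | (i < j)%N) f i * (2 - f j))%N.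
Proof.
elim: N f s => [|N IH] f s.
  rewrite (_ : enum 'I_0 = [::]); last by apply/size0nil; rewrite size_enum_ord.
  by rewrite !big_ord0 muln0 mulr1.
have -> : (\sum_(i < N.+1) \sum_(j < N.+1 | i < j) f i * (2 - f j) =
  f ord0 * (\sum_(j < N) (2 - f (lift ord0 j))) +
  \sum_(i < N) \sum_(j < N | i < j) f (lift ord0 i) * (2 - f (lift ord0 j)))%N.
  rewrite big_ord_recl; congr (_ + _)%N.
    by rewrite big_mkcond big_ord_recl /= add0n big_distrr.
  apply: eq_bigr => i _; rewrite big_mkcond big_ord_recl /= add0n [RHS]big_mkcond.
  exact: eq_bigr.
rewrite enum_ordSl /= -map_comp IH /= ![in RHS]big_ord_recl /boundary_factor.
rewrite (_ : (if f ord0 == 1%N then e else 1) = e ^+ (f ord0 == 1%N)); last by case: (f ord0 == 1%N).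
by rewrite !mulnDl !mulnDr !exprD; ring.
Qed.

End BoundaryWeight.

(** * Partition functions of several columns *)

Section LatticeFacts.
Variables (F : fieldType) (P : eqType).
Implicit Types (w : nat -> P -> nat -> nat -> nat -> nat -> F) (ps : seq P).

Lemma eq_column (v v' : P -> nat -> nat -> nat -> nat -> F) ps i k J L :
  (forall p i j k l, p \in ps -> v p i j k l = v' p i j k l) ->
  column v ps i k J L = column v' ps i k J L.
Proof.
elim: ps i J L => [|p ps IH] i [|j J] [|l L] //= H.
apply: eq_bigr => m _; rewrite H ?mem_head // IH // => p' *; apply: H.
by rewrite inE orbC; apply/orP; left.
Qed.

Lemma eq_lattice w w' ps s K :
  (forall c p i j k l, p \in ps -> w c p i j k l = w' c p i j k l) ->
  lattice w ps s K = lattice w' ps s K.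
Proof.
elim: s w w' K => //= a s IH w w' K H; apply: eq_bigr => L _.
by rewrite (eq_column (v' := w' 0%N)) ?(IH _ (fun c => w' c.+1)) // => *; exact: H.
Qed.

Lemma lattice_conserve w ps s K :
  (forall c p i j k l, w c p i j k l != 0 -> (i + j = k + l)%N) ->
  lattice w ps s K != 0 -> sumn K = sumn s.
Proof.
elim: s w K => [|a s IH] w K H /=.
  by case: (K =P _) => [->|]; rewrite ?eqxx // sumn_nseq.
move=> h; have /hasP[L _ hL] : has (fun L => column (w 0%N) ps 0 a K L *
    lattice (fun c => w c.+1) ps s L != 0) (words (size ps)).
  apply: contraNT h => /hasPn h; rewrite big_seq big1 // => L hL.
  by apply/eqP; have := h L hL; rewrite negbK.
move: hL; rewrite mulf_eq0 negb_or => /andP[/(column_conserve (H 0%N)) h1 /IH h2].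
by rewrite -h2 // => c; exact: H.
Qed.

Lemma lattice_pad w ps s n K : K \in words (size ps) ->
  (forall c p i j k l, w c p i j k l != 0 -> (i + j = k + l)%N) ->
  (forall c p, p \in ps -> w c p 0 0 0 0 = 1) ->
  lattice w ps (s ++ nseq n 0%N) K = lattice w ps s K.
Proof.
move=> + H H1; elim: s w K H H1 => [|a s IH] w K H H1 hK /=; last first.
  by apply: eq_big_seq => L hL; rewrite (IH _ L (fun c => H c.+1) (fun c => H1 c.+1) hL).
elim: n w K H H1 hK => //= n IH w K H H1 hK.
rewrite (eq_big_seq (fun L => column (w 0%N) ps 0 0 K L * (L == nseq (size ps) 0%N)%:R)); last first.
  by move=> L hL; rewrite (IH _ L (fun c => H c.+1) (fun c => H1 c.+1) hL).
rewrite sum_words_delta; last by rewrite mem_words size_nseq eqxx all_nseq orbT.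
by rewrite (column_zero_right (H 0%N)) // => p; exact: H1.
Qed.

End LatticeFacts.

(** The sum of [(k + 1) s_k], written as the sum of the weights of the suffixes of [s]. *)
Fixpoint position_weight (s : seq nat) : nat :=
  if s is a :: s' then (a + sumn s' + position_weight s')%N else 0%N.

Section IterateLattice.
Variables (F : numFieldType) (q : F) (xs ys : seq F) (z : nat -> F).

(** The constant [(-1)^(|S|/2) c_S(q)] of the 2-string with the letters [s]. *)
Definition string_coef (s : seq nat) : F :=
  q ^+ (2 * position_weight s) * \prod_(a <- s) (gauge q a)^-1.

Lemma iterate_lattice s k I J (wx wy : nat -> F -> nat -> nat -> nat -> nat -> F) :
  (forall c, wx c = ikweight q (z (k + c)%N)) ->
  (forall c, wy c = ikweight q (q ^- 3 * (z (k + c)%N)^-1)) ->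
  iterate (pair_states xs ys) (string_entry q xs ys z)
    (fun K => (K == ground_pair xs ys)%:R) s k (I, J) =
  string_coef s * (lattice wx xs s I * lattice wy ys s J).
Proof.
elim: s k I J wx wy => [|a s IH] k I J wx wy hx hy /=.
  by rewrite /string_coef muln0 big_nil !mul1r -natrM mulnb.
have conserve_x : forall c x i j k l, wx c x i j k l != 0 -> (i + j = k + l)%N.
  by move=> c x i j m l; rewrite hx; exact: ikweight_conserve.
have conserve_y : forall c y i j k l, wy c y i j k l != 0 -> (i + j = k + l)%N.
  by move=> c x i j m l; rewrite hy; exact: ikweight_conserve.
pose lx := lattice (fun c => wx c.+1) xs s; pose ly := lattice (fun c => wy c.+1) ys s.
have sum_x I1 : lx I1 != 0 -> sumn I1 = sumn s by apply: lattice_conserve => c; exact: conserve_x.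
have sum_y J1 : ly J1 != 0 -> sumn J1 = sumn s by apply: lattice_conserve => c; exact: conserve_y.
pose G I1 J1 := pair_entry q (z k) xs ys a I J I1 J1 * (string_coef s * (lx I1 * ly J1)).
rewrite (eq_bigr (fun K => G K.1 K.2)) => [|[I1 J1] _]; last first.
  rewrite (IH k.+1 I1 J1 (fun c => wx c.+1) (fun c => wy c.+1)) => [//|c|c].
    by rewrite hx addSnnS.
  by rewrite hy addSnnS.
rewrite (@sum_pair_states _ _ _ G) => [|I1 J1 _ _]; last first.
  by rewrite /G !mulf_eq0 !negb_or => /andP[_ /andP[_ /andP[/sum_x -> /sum_y ->]]].
rewrite big_distrlr /= mulr_sumr; apply: eq_bigr => I1 _; rewrite mulr_sumr; apply: eq_bigr => J1 _.
rewrite /G /pair_entry -/(lx I1) -/(ly J1) hx hy addn0.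
have [->|nl] := eqVneq (ly J1) 0; first by rewrite !mulr0.
have [->|nc] := eqVneq (column (ikweight q (q ^- 3 / z k)) ys 0 a J J1) 0; first by rewrite ?(mulr0, mul0r).
have -> : sumn J = (a + sumn s)%N.
  by have := column_conserve (@ikweight_conserve _ _ _) nc; rewrite (sum_y _ nl).
by rewrite /string_coef /= big_cons !mulnDr !exprD; ring.
Qed.

End IterateLattice.

(** * 2-strings and words *)

Section TwoStrings.
Implicit Types S : two_string.

(** The first [L] letters of a 2-string. *)
Definition string_word S L : seq nat := [seq nat_of_ord (S c) | c <- iota 0 L].

Lemma string_word_words S L : string_word S L \in words L.
Proof.
rewrite mem_words size_map size_iota eqxx all_map; apply/allP => c _ /=.
exact: ltn_ord.
Qed.

Lemma string_len_zero S c : (string_len S <= c)%N -> S c = ord0.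
Proof.
move=> h; have [hc|] := boolP (c \in finsupp S); last exact: fsfun_dflt.
have := @leq_bigmax_seq _ (finsupp S : seq nat) xpredT (fun c => c.+1) c hc isT.
by rewrite leqNgt ltnS h.
Qed.

(** A sum or product over the support of a 2-string may run over any initial segment containing
    it. *)
Lemma big_finsupp (T : Type) (idx : T) (op : Monoid.com_law idx) (f : nat -> T) S L :
  (string_len S <= L)%N -> (forall c, S c = ord0 -> f c = idx) ->
  \big[op/idx]_(c <- finsupp S) f c = \big[op/idx]_(c <- iota 0 L) f c.
Proof.
move=> hL f0; rewrite [RHS](bigID (mem (finsupp S))) /= [X in op _ X]big1 ?Monoid.mulm1.
  rewrite -[RHS]big_filter; apply: perm_big; apply: uniq_perm.
  - exact: fset_uniq.
  - exact/filter_uniq/iota_uniq.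
  - move=> c; rewrite mem_filter mem_iota add0n /=; case: (boolP (c \in finsupp S)) => //= hc.
    have := @leq_bigmax_seq _ (finsupp S : seq nat) xpredT (fun c => c.+1) c hc isT.
    by move=> h; apply/esym; exact: leq_trans hL.
by move=> c hc; apply/f0/fsfun_dflt.
Qed.

Lemma string_weight_word S L : (string_len S <= L)%N -> string_weight S = sumn (string_word S L).
Proof.
move=> hL; rewrite /string_weight (big_finsupp _ hL) => [|c -> //].
by rewrite /string_word sumnE big_map.
Qed.

Lemma string_count_word i S L : (string_len S <= L)%N -> i != 0%N ->
  string_count i S = count_mem i (string_word S L).
Proof.
move=> hL hi; rewrite /string_count -sum1_count big_mkcond /=.
rewrite (big_finsupp _ hL) => [|c ->]; last by rewrite /= eq_sym (negPf hi).
by rewrite -big_mkcond sum1_count count_map.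
Qed.

Lemma string_word_pad S L : (string_len S <= L)%N ->
  string_word S L = string_word S (string_len S) ++ nseq (L - string_len S) 0%N.
Proof.
move=> hL; rewrite -{1}(subnKC hL) /string_word iotaD map_cat add0n; congr (_ ++ _).
have zeros m n : (string_len S <= m)%N -> [seq nat_of_ord (S c) | c <- iota m n] = nseq n 0%N.
  by elim: n m => //= n IH m hm; rewrite string_len_zero // IH // leqW.
exact: zeros.
Qed.

Lemma position_weight_iota (f : nat -> nat) m L :
  (position_weight [seq f c | c <- iota m L] + m * \sum_(c <- iota m L) f c =
  \sum_(c <- iota m L) c.+1 * f c)%N.
Proof.
elim: L m => [|L IH] m; first by rewrite !big_nil muln0.
rewrite /= !big_cons -IH sumnE big_map; lia.
Qed.

End TwoStrings.

(** * The functions F, H and the constant c of a 2-string *)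

Section ComplexLattice.
Variable R : realType.
Implicit Types (q x y : R[i]).

Lemma IKweightE q x y i j k l : (x - q ^+ 2 * y) * (x - q ^+ 3 * y) != 0 ->
  IKweight q x y i j k l = ikweight q y x i j k l.
Proof.
rewrite mulf_eq0 negb_or => /andP[h2 h3].
have cancel a : a / (x - q ^+ 2 * y) = a * (x - q ^+ 3 * y) / ((x - q ^+ 2 * y) * (x - q ^+ 3 * y)).
  by rewrite -mulf_div divff // mulr1.
move: i j k l => [|[|[|i]]] [|[|[|j]]] [|[|[|k]]] [|[|[|l]]];
  rewrite /IKweight /ikweight /ikpoly ?mul0r ?cancel ?mulNr //; by rewrite divff // mulf_neq0.
Qed.

Section Rows.
Variable N : nat.
Variables (q : R[i]) (X : 'I_N -> R[i]) (z : nat -> R[i]).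
Hypothesis hz : forall k, z k != 0.
Let xs := [seq X r | r <- enum 'I_N].
Hypothesis hX : forall x, x \in xs -> off_poles q x z.

Let size_xs : size xs = N. Proof. by rewrite size_map size_enum_ord. Qed.

Lemma IK_F_lattice I S L : (string_len S <= L)%N ->
  IK_F q I X z S = lattice (fun c x => ikweight q (z c) x) xs (string_word S L) (word_of I).
Proof.
move=> hL; rewrite /IK_F /partition_function.
rewrite (@lattice_sum _ _ N _ (fun c x i j k l => IKweight q x (z c) i j k l)) -/xs -/(string_word _ _).
rewrite (string_word_pad hL) lattice_pad.
- by apply: eq_lattice => c x i j k l /hX hx; rewrite IKweightE // off_poles_neq0.
- by rewrite mem_words size_xs size_word_of eqxx all_map; apply/allP => r _ /=.
- by move=> c x i j k l; exact: ikweight_conserve.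
- by move=> c x /hX hx; rewrite ikweight_empty // off_poles_neq0.
Qed.

Lemma comp_weight_word (I : {ffun 'I_N -> 'I_3}) : comp_weight I = sumn (word_of I).
Proof. by rewrite sumnE big_map big_enum. Qed.

Lemma IK_H_words S L : (string_len S <= L)%N ->
  IK_H q X z S = \sum_(K <- words N) boundary_weight q ('i * (1 - q^-1)) 0 K *
    lattice (fun c x => ikweight q (z c) x) xs (string_word S L) K.
Proof.
move=> hL; rewrite -big_word_of /IK_H big_mkcond; apply: eq_bigr => I _.
rewrite (IK_F_lattice I hL); case: eqP => hI.
  rewrite /word_of boundary_weight_enum mul0n add0n -/(word_of I); congr (_ * _).
  have -> : (\sum_(r < N) (nat_of_ord (I r) == 1%N))%N = comp_ones I.
    rewrite /comp_ones -sum1_card [RHS]big_mkcond /=; apply: eq_bigr => r _.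
    by rewrite inE; case: eqP.
  by rewrite exprMn exprVn.
rewrite [lattice _ _ _ _](_ : _ = 0) ?mulr0 //; apply/eqP; apply: contraT.
move=> /lattice_conserve h; case: hI; rewrite comp_weight_word (string_weight_word hL).
by apply: h => c x i j k l; exact: ikweight_conserve.
Qed.

End Rows.

Lemma string_coefE q S L : (string_len S <= L)%N ->
  'i ^+ string_weight S * string_const q S = string_coef q (string_word S L) :> R[i].
Proof.
move=> hL; rewrite /string_const (string_weight_word hL) !(string_count_word hL) //.
rewrite (big_finsupp _ hL) => [|c ->]; last by rewrite muln0.
have -> : \prod_(k <- iota 0 L) q ^+ (2 * k.+1 * S k) = q ^+ (2 * position_weight (string_word S L)).
  have := position_weight_iota (fun c => S c) 0 L; rewrite mul0n addn0 => ->.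
  by rewrite big_distrr /= expr_sum; apply: eq_bigr => k _; rewrite mulnA.
rewrite /string_coef [RHS]mulrC !mulrA; congr (_ * _).
have := string_word_words S L; rewrite mem_words => /andP[_].
elim: (string_word S L) => [_|a s IH /= /andP[ha hs]]; first by rewrite big_nil !expr0 !invr1 !mulr1.
have ii : 'i * 'i = -1 :> R[i] by rewrite -expr2 sqr_i.
rewrite big_cons -IH //; case: a ha => [|[|[|]]] //= _.
- by rewrite !add0n invr1 mul1r.
- rewrite add0n !exprD !expr1 !invfM -[q - 1]opprB invrN.
  set A := 'i ^+ sumn s; set B := 'i ^+ _; set C := ((1 - q) ^+ _)^-1; set D := (q ^+ _)^-1.
  transitivity ('i * 'i * ((1 - q)^-1 * (A * B * C * D))); first by ring.
  by rewrite ii; ring.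
- rewrite add0n !exprD !expr1 !invfM invrN expr2.
  set A := 'i ^+ sumn s; set B := 'i ^+ _; set C := ((1 - q) ^+ _)^-1; set D := (q ^+ _)^-1.
  transitivity ('i * 'i * (q^-1 * (A * B * C * D))); first by ring.
  by rewrite ii; ring.
Qed.

End ComplexLattice.

(** * Summation over all 2-strings *)

(** The 2-string whose first letters are [w] and whose other letters are 0. *)
Definition string_of (w : seq nat) : two_string :=
  [fsfun c in [fset c in iota 0 (size w)]%fset => (inord (nth 0%N w c) : 'I_3)].

Lemma string_ofE w c : (forall a, a \in w -> a < 3)%N -> string_of w c = nth 0%N w c :> nat.
Proof.
move=> hw; rewrite fsfunE inE mem_iota /= add0n; case: ltnP => hc; last by rewrite nth_default.
by rewrite inordK // hw // mem_nth.
Qed.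

Lemma string_ofK L w : w \in words L -> string_word (string_of w) L = w.
Proof.
move=> hw; have sw : size w = L by move: hw; rewrite mem_words => /andP[/eqP].
apply: (@eq_from_nth _ 0%N) => [|i]; rewrite size_map size_iota // => hi.
by rewrite (nth_map 0%N) ?size_iota // nth_iota // add0n string_ofE //; apply: words_letter hw.
Qed.

Lemma string_wordK S L : (string_len S <= L)%N -> string_of (string_word S L) = S.
Proof.
move=> hL; apply/fsfunP => c; apply: val_inj.
rewrite /= string_ofE; last exact: (words_letter (string_word_words S L)).
have [hc|hc] := ltnP c L; first by rewrite (nth_map 0%N) ?size_iota // nth_iota.
by rewrite nth_default ?size_map ?size_iota // string_len_zero // (leq_trans hL).
Qed.

Lemma string_len_of L w : w \in words L -> (string_len (string_of w) <= L)%N.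
Proof.
move=> hw; apply/bigmax_leqP_seq => c; rewrite mem_finsupp => hc _.
rewrite ltnNge; apply: contra hc => hc; rewrite -val_eqE /= string_ofE; last exact: words_letter hw.
by rewrite nth_default //; move: hw; rewrite mem_words => /andP[/eqP-> _].
Qed.

Lemma string_of_rcons0 L w : w \in words L -> string_of (rcons w 0%N) = string_of w.
Proof.
move=> hw; apply/fsfunP => c; apply: val_inj; have hl := words_letter hw.
rewrite /= !string_ofE // => [|a].
  by rewrite nth_rcons if_same; case: ltnP => // h; rewrite nth_default.
by rewrite mem_rcons inE => /predU1P[->|/hl].
Qed.

(** By Bernoulli's inequality [r^n] is at most [1 / (1 + n (1 - r))]. *)
Lemma bernoulli_decay (K : numDomainType) (r : K) n : 0 <= r -> r <= 1 ->
  r ^+ n * (1 + n%:R * (1 - r)) <= 1.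
Proof.
move=> r0 r1; elim: n => [|n IH]; first by rewrite mul0r addr0 mulr1.
apply: le_trans IH; rewrite exprSr -mulrA ler_wpM2l ?exprn_ge0 // -subr_ge0.
rewrite (_ : _ - _ = n.+1%:R * (1 - r) ^+ 2); last by rewrite -!natr1; ring.
by rewrite mulr_ge0 ?exprn_ge0 ?subr_ge0.
Qed.

Section HasSum.
Variable R : realType.

Lemma geometric_small (r c : R[i]) (e : R) : 0 <= r -> r < 1 -> 0 <= c -> 0 < e ->
  exists L, c * r ^+ L < e%:C.
Proof.
move=> r0 r1 c0 e0.
have rE : r = (complex.Re r)%:C by move: r0; case: r {r1} => a b; rewrite lecE /= => /andP[/eqP-> _].
have cE : c = (complex.Re c)%:C by move: c0; case: c => a b; rewrite lecE /= => /andP[/eqP-> _].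
move: r0 r1 c0; rewrite rE cE; clear rE cE; move: (complex.Re r) (complex.Re c) => {}r {}c; rewrite !lecR.
rewrite (_ : 1 = 1%:C) // ltcR => r0 r1 c0.
have u0 : 0 < 1 - r by rewrite subr_gt0.
have eu0 : 0 < e * (1 - r) by rewrite mulr_gt0.
have [L hL] : exists L : nat, c / (e * (1 - r)) < L%:R.
  by exists (Num.bound (c / (e * (1 - r)))); apply: le_lt_trans (archi_boundP _); rewrite ?divr_ge0 // ltW.
exists L; rewrite -rmorphXn -rmorphM ltcR.
have b := bernoulli_decay L r0 (ltW r1).
have pos : 0 < 1 + L%:R * (1 - r) by rewrite ltr_pwDl // mulr_ge0 // ltW.
rewrite -(ltr_pM2r pos) -mulrA; apply: le_lt_trans (ler_wpM2l c0 b) _.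
rewrite mulr1 mulrDr mulr1 ltr_wpDl // ?ltW //.
by move: hL; rewrite ltr_pdivrMr // => hL; rewrite mulrCA.
Qed.

(** Unconditional summability: every 2-string is a word followed by zeros, and the strings which
    are not words of length [L] end with a nonzero letter at a later place. *)
Lemma has_sum_words (f : two_string -> R[i]) (s r c : R[i]) :
  0 <= r -> r < 1 -> 0 <= c ->
  (forall L, `|\sum_(w <- words L) f (string_of w) - s| <= c * r ^+ L) ->
  (forall L a, (0 < a < 3)%N -> \sum_(w <- words L) `|f (string_of (rcons w a))| <= c * r ^+ L) ->
  has_sum f s.
Proof.
move=> r0 r1 c0 conv tail e e0.
pose a L := \sum_(w <- words L) `|f (string_of w)|.
pose A L : {fset two_string} := [fset S in [seq string_of w | w <- words L]]%fset.
have u0 : 0 < 1 - r by rewrite subr_gt0.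
have uniqA L : uniq [seq string_of w | w <- words L].
  rewrite map_inj_in_uniq ?words_uniq // => w w' hw hw' ww'.
  by rewrite -(string_ofK hw) ww' string_ofK.
have sumA L (g : two_string -> R[i]) : \sum_(S <- A L) g S = \sum_(w <- words L) g (string_of w).
  rewrite -(big_map string_of xpredT g); apply: perm_big; apply: uniq_perm => //.
  by move=> S; rewrite /A inE.
have mono L n : a (L + n)%N + 2 * c * r ^+ (L + n) / (1 - r) <= a L + 2 * c * r ^+ L / (1 - r).
  elim: n => [|n IH]; first by rewrite addn0.
  apply: le_trans IH; rewrite addnS; set m := (L + n)%N.
  have -> : a m.+1 = a m +
      \sum_(w <- words m) (`|f (string_of (rcons w 1%N))| + `|f (string_of (rcons w 2%N))|).
    rewrite /a big_words_rcons -big_split; apply: eq_big_seq => w hw.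
    by rewrite big_ord3 /= (string_of_rcons0 hw) addrA.
  rewrite -!addrA lerD2l big_split /=.
  apply: (@le_trans _ _ (c * r ^+ m + c * r ^+ m + 2 * c * r ^+ m.+1 / (1 - r))).
    by rewrite lerD2r lerD // tail.
  rewrite le_eqVlt; apply/orP; left; apply/eqP.
  by rewrite exprSr; field; rewrite gt_eqF.
(* The distance of the partial sum to [s], plus the geometric tails of the two nonzero letters. *)
pose kap := c + 2 * c / (1 - r).
have kap0 : 0 <= kap by rewrite addr_ge0 // divr_ge0 ?mulr_ge0 // ltW.
have [L hL] := geometric_small r0 r1 kap0 e0.
exists (A L) => B hB; apply: le_lt_trans hL.
have [L' LL' hB'] : exists2 L', (L <= L')%N & {subset B <= A L'}.
  pose m := (\max_(S <- (B : seq two_string)) string_len S)%N.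
  exists (maxn L m); first exact: leq_maxl.
  move=> S hS; rewrite /A inE; apply/mapP; exists (string_word S (maxn L m)).
    exact: string_word_words.
  rewrite string_wordK // leq_max; apply/orP; right.
  exact: (@leq_bigmax_seq _ (B : seq two_string) xpredT string_len S hS isT).
have sub : {subset A L <= B} by apply/fsubsetP.
have split1 := big_subseq_split f (fset_uniq (A L)) (fset_uniq B) sub.
have split2 := big_subseq_split (fun S => `|f S|) (fset_uniq (A L)) (fset_uniq B) sub.
have split3 := big_subseq_split (fun S => `|f S|) (fset_uniq B) (fset_uniq (A L')) hB'.
have tailB : `|\sum_(S <- B | S \notin A L) f S| <= a L' - a L.
  apply: le_trans (ler_norm_sum _ _ _) _.
  rewrite lerBrDl /a -(sumA L (fun S => `|f S|)) -(sumA L' (fun S => `|f S|)) -split2 split3 lerDl.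
  by apply: sumr_ge0.
rewrite split1 sumA addrAC; apply: le_trans (ler_normD _ _) _.
apply: (@le_trans _ _ (c * r ^+ L + (a L' - a L))); first exact: lerD.
rewrite /kap mulrDl lerD2l lerBlDl.
have := mono L (L' - L)%N; rewrite subnKC // => hm.
apply: le_trans (le_trans _ hm) _; first by rewrite lerDl !(mulr_ge0, invr_ge0, exprn_ge0) // ltW.
by rewrite mulrAC.
Qed.

End HasSum.

(** * The terms of the series and the four ratios *)

Section Summand.
Variables (R : realType) (N M : nat) (q : R[i]).
Variables (x : 'I_N -> R[i]) (y : 'I_M -> R[i]) (z : nat -> R[i]).
Let xs := [seq x r | r <- enum 'I_N].
Let ys := [seq y r | r <- enum 'I_M].
Let z' k := q ^- 3 * (z k)^-1.
Hypothesis (hq : q != 0) (hz : forall k, z k != 0).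
Hypothesis hxz : forall u, u \in xs -> off_poles q u z.
Hypothesis hyz : forall u, u \in ys -> off_poles q u z'.

(** A term of the series, as an entry of a product of columns applied to the empty state. *)
Lemma summand_string S L : (string_len S <= L)%N ->
  'i ^+ string_weight S * q ^ ((4 * M * N)%N%:Z - (string_weight S ^ 2)%N%:Z) * string_const q S
    * IK_H q x z S * IK_H q y z' S =
  q ^+ (4 * M * N) * \sum_(K <- pair_states xs ys)
    boundary_weight q ('i * (1 - q^-1)) 0 (K.1 ++ dual_word K.2) *
    iterate (pair_states xs ys) (string_entry q xs ys z) (fun K => (K == ground_pair xs ys)%:R)
      (string_word S L) 0 K.
Proof.
move=> hL.
have hz' k : z' k != 0 by rewrite mulf_neq0 ?invr_eq0 ?expf_neq0.
have sx : size xs = N by rewrite size_map size_enum_ord.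
have sy : size ys = M by rewrite size_map size_enum_ord.
pose wx c u := ikweight q (z c) u; pose wy c u := ikweight q (z' c) u.
pose s := string_word S L.
rewrite expfzDr // -exprnN -exprnP -exprVn.
transitivity (q ^+ (4 * M * N) * (q^-1 ^+ (string_weight S ^ 2) * string_coef q s *
  (IK_H q x z S * IK_H q y z' S))).
  have ac (a b c d f g : R[i]) : a * (b * c) * d * f * g = b * (c * (a * d) * (f * g)) by ring.
  by rewrite /s -(string_coefE q hL); exact: ac.
rewrite (IK_H_words hz hxz hL) (IK_H_words hz' hyz hL) -/s -/xs -/ys; congr (_ * _).
pose G I J := boundary_weight q ('i * (1 - q^-1)) 0 (I ++ dual_word J) *
  (string_coef q s * (lattice wx xs s I * lattice wy ys s J)).
have conserve_x I : lattice wx xs s I != 0 -> sumn I = sumn s.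
  by apply: lattice_conserve => c u i j k l; exact: ikweight_conserve.
have conserve_y J : lattice wy ys s J != 0 -> sumn J = sumn s.
  by apply: lattice_conserve => c u i j k l; exact: ikweight_conserve.
rewrite [RHS](eq_bigr (fun K => G K.1 K.2)) => [|[I J] _]; last first.
  by rewrite (@iterate_lattice _ q xs ys z s 0 I J wx wy).
rewrite (@sum_pair_states _ _ _ G) => [|I J _ _]; last first.
  by rewrite /G !mulf_eq0 !negb_or => /andP[_ /andP[_ /andP[/conserve_x -> /conserve_y ->]]].
rewrite sx sy big_distrlr /= mulr_sumr; apply: eq_big_seq => I hI.
rewrite mulr_sumr; apply: eq_big_seq => J hJ.
rewrite /G (boundary_weight_pair _ _ hI hJ) -/(wx _) -/(wy _).
have [->|/conserve_x cx] := eqVneq (lattice wx xs s I) 0; first by rewrite ?(mulr0, mul0r).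
have [->|/conserve_y cy] := eqVneq (lattice wy ys s J) 0; first by rewrite ?(mulr0, mul0r).
rewrite cx cy (string_weight_word hL) -/s -mulnn.
have ac (a b c d f g : R[i]) : a * b * (c * d * (f * g)) = c * f * a * (b * (d * g)) by ring.
exact: ac.
Qed.

End Summand.

Lemma uniformly_off_polesE (R : realType) (q x : R[i]) z :
  uniformly_off_poles q x z -> off_poles q x z.
Proof. by move=> [d d0 H]; exists d%:C => //; rewrite ltcR. Qed.

Lemma pairwise_codom (T : eqType) n (f : 'I_n -> T) (r : rel T) :
  (forall i j, i != j -> r (f i) (f j)) -> pairwise r [seq f i | i <- enum 'I_n].
Proof.
move=> H; rewrite pairwise_map; have := enum_uniq 'I_n; rewrite uniq_pairwise.
by apply: sub_pairwise => i j; exact: H.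
Qed.

(** The ratios in the hypotheses are the diagonal weights of the two lattices, up to powers of [q]
    in the case of the [y] rows. *)
Lemma ratio_x1 (R : realType) (q x z : R[i]) : (x - q ^+ 2 * z) * (x - q ^+ 3 * z) != 0 ->
  ikweight q z x 0 1 0 1 = (x - z) / (x - q ^+ 2 * z).
Proof. by move=> h; rewrite -IKweightE. Qed.

Lemma ratio_x2 (R : realType) (q x z : R[i]) :
  ikweight q z x 0 2 0 2 = (x - z) * (x - q * z) / ((x - q ^+ 2 * z) * (x - q ^+ 3 * z)).
Proof. by []. Qed.

Section DualRatios.
Variables (R : realType) (q y z : R[i]).
Hypothesis (hq : q != 0) (hz : z != 0).
Let z' := q ^- 3 * z^-1.
Hypothesis hD : (y - q ^+ 2 * z') * (y - q ^+ 3 * z') != 0.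

Lemma dual_poles : (1 - y * z != 0) /\ (1 - q * y * z != 0).
Proof.
by move: hD; rewrite dual_denominator // !mulf_eq0 !negb_or mulrA => /andP[/andP[-> ->]].
Qed.

Lemma ratio_y1 : q ^+ (2 * 1) * ikweight q z' y 0 1 0 1 = (1 - q ^+ 3 * y * z) / (1 - q * y * z).
Proof.
have [h1 h2] := dual_poles.
rewrite ratio_x1 // (_ : y - q ^+ 2 * z' = - (1 - q * y * z) / (q * z)); last first.
  by rewrite /z'; field; rewrite hq hz.
by rewrite /z'; field; rewrite ?hq ?hz ?h2.
Qed.

Lemma ratio_y2 : q ^+ (2 * 2) * ikweight q z' y 0 2 0 2 =
  (1 - q ^+ 2 * y * z) * (1 - q ^+ 3 * y * z) / ((1 - y * z) * (1 - q * y * z)).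
Proof.
have [h1 h2] := dual_poles.
rewrite ratio_x2 dual_denominator // [q * (y * z)]mulrA.
by rewrite /z'; field; rewrite ?hq ?hz ?h1 ?h2.
Qed.

End DualRatios.

Unset Implicit Arguments.

Theorem theorem1p7p4 (R : realType) (N M : nat) (hN : (0 < N)%N) (hM : (0 < M)%N)
  (q : R[i]) (x : 'I_N -> R[i]) (y : 'I_M -> R[i]) (z : nat -> R[i])
  (eps : R) (heps : eps < 1)
  (* nondegeneracy: away from the poles *)
  (hq0 : q != 0) (hq1 : q != 1) (hz : forall k, z k != 0)
  (hxy : forall i j, x i * y j != 1) (hqxy : forall i j, q * x i * y j != 1)
  (hxz : forall i, uniformly_off_poles q (x i) z)
  (hyz : forall j, uniformly_off_poles q (y j) (fun k => q ^- 3 * (z k)^-1))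
  (* the two displayed conditions *)
  (h1 : forall i j k,
    `|(1 - q ^+ 3 * y j * z k) / (1 - q * y j * z k)
      * ((x i - z k) / (x i - q ^+ 2 * z k))| < eps%:C)
  (h2 : forall i j k,
    `|(1 - q ^+ 2 * y j * z k) * (1 - q ^+ 3 * y j * z k)
        / ((1 - y j * z k) * (1 - q * y j * z k))
      * ((x i - z k) * (x i - q * z k)
        / ((x i - q ^+ 2 * z k) * (x i - q ^+ 3 * z k)))| < eps%:C)
  (* the analogous conditions pairing a state 2 with two states 1 *)
  (h12 : forall i j j' k, j != j' ->
    `|(1 - q ^+ 3 * y j * z k) / (1 - q * y j * z k)
      * ((1 - q ^+ 3 * y j' * z k) / (1 - q * y j' * z k))
      * ((x i - z k) * (x i - q * z k)
        / ((x i - q ^+ 2 * z k) * (x i - q ^+ 3 * z k)))| < eps%:C)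
  (h21 : forall i i' j k, i != i' ->
    `|(1 - q ^+ 2 * y j * z k) * (1 - q ^+ 3 * y j * z k)
        / ((1 - y j * z k) * (1 - q * y j * z k))
      * ((x i - z k) / (x i - q ^+ 2 * z k))
      * ((x i' - z k) / (x i' - q ^+ 2 * z k))| < eps%:C) :
  has_sum
    (fun S : two_string =>
      'i ^+ string_weight S
      * q ^ ((4 * M * N)%N%:Z - (string_weight S ^ 2)%N%:Z)
      * string_const q S
      * IK_H q x z S
      * IK_H q y (fun k => q ^- 3 * (z k)^-1) S)
    (\prod_(i < N) \prod_(j < M)
      ((1 - q ^+ 2 * x i * y j) * (1 - q ^+ 3 * x i * y j)
       / ((1 - x i * y j) * (1 - q * x i * y j)))).
Proof.
pose xs := [seq x r | r <- enum 'I_N]; pose ys := [seq y r | r <- enum 'I_M].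
pose z' k := q ^- 3 * (z k)^-1.
have sx : size xs = N by rewrite size_map size_enum_ord.
have sy : size ys = M by rewrite size_map size_enum_ord.
have hz' k : z' k != 0 by rewrite mulf_neq0 ?invr_eq0 ?expf_neq0.
have off_x u : u \in xs -> off_poles q u z by move=> /mapP[i _ ->]; apply: uniformly_off_polesE.
have off_y u : u \in ys -> off_poles q u z' by move=> /mapP[j _ ->]; apply: uniformly_off_polesE.
have Dx i k : (x i - q ^+ 2 * z k) * (x i - q ^+ 3 * z k) != 0.
  by apply: off_poles_neq0 => //; apply: uniformly_off_polesE.
have Dy j k : (y j - q ^+ 2 * z' k) * (y j - q ^+ 3 * z' k) != 0.
  by apply: off_poles_neq0 => //; apply: uniformly_off_polesE.
have he : ('i * (1 - q^-1)) ^+ 2 = - (1 - q^-1) ^+ 2 :> R[i] by rewrite exprMn sqr_i mulN1r.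
have ny1 j k := ratio_y1 hq0 (hz k) (Dy j k).
have ny2 j k := ratio_y2 hq0 (hz k) (Dy j k).
have eps0 : 0 <= eps%:C by apply: ltW; apply: le_lt_trans (h1 (Ordinal hN) (Ordinal hM) 0%N).
have eps1 : eps%:C < 1 by rewrite (_ : 1 = 1%:C) // ltcR.
have [||||r [c [r0 r1 c0 conv tail]]] := @string_estimates _ q ('i * (1 - q^-1)) hq0 hq1 he xs ys z eps%:C
  hz off_x off_y eps0 eps1.
- move=> k _ _ /mapP[i _ ->] /mapP[j _ ->]; rewrite -normrM ny1 ratio_x1 // mulrC.
  exact/ltW/h1.
- move=> k _ _ /mapP[i _ ->] /mapP[j _ ->]; rewrite -normrM ny2 ratio_x2 mulrC.
  exact/ltW/h2.
- move=> k _ /mapP[i _ ->]; apply: pairwise_codom => j j' hj.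
  by rewrite !ny1 ratio_x2 -!normrM mulrC; exact/ltW/h12.
- move=> k _ /mapP[j _ ->]; apply: pairwise_codom => i i' hi.
  by rewrite !ny2 !ratio_x1 // -!normrM mulrC mulrA; exact/ltW/h21.
pose alpha := \prod_(u <- xs) \prod_(v <- ys) ((1 - u * v) * (1 - q * (u * v))).
pose sigma := \prod_(u <- xs) \prod_(v <- ys) crossing_scale q u v.
pose t s := \sum_(K <- pair_states xs ys) boundary_weight q ('i * (1 - q^-1)) 0 (K.1 ++ dual_word K.2) *
  iterate (pair_states xs ys) (string_entry q xs ys z) (fun K => (K == ground_pair xs ys)%:R) s 0 K.
have {}conv L : `|alpha * \sum_(s <- words L) t s - sigma * q^-1 ^+ (4 * size ys * size xs)| <= c * r ^+ L.
  exact: conv.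
have {}tail L a : (0 < a < 3)%N -> \sum_(s <- words L) `|t (rcons s a)| <= c * r ^+ L by exact: tail.
have alpha0 : alpha != 0.
  rewrite /alpha prodf_seq_neq0; apply/allP => _ /mapP[i _ ->]; rewrite prodf_seq_neq0.
  by apply/allP => _ /mapP[j _ ->]; rewrite /= mulf_neq0 // subr_eq0 eq_sym // mulrA.
pose Q := q ^+ (4 * M * N).
have -> : \prod_(i < N) \prod_(j < M) ((1 - q ^+ 2 * x i * y j) * (1 - q ^+ 3 * x i * y j)
       / ((1 - x i * y j) * (1 - q * x i * y j))) = sigma / alpha.
  rewrite /sigma /alpha /xs /ys !big_map -prodf_div; apply: eq_bigr => i _.
  rewrite !big_map -prodf_div; apply: eq_bigr => j _.
  by rewrite /crossing_scale !mulrA.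
pose C := c * (`|Q / alpha| + `|Q|).
have C0 : 0 <= C by rewrite mulr_ge0 // addr_ge0.
set f := (fun S : two_string => _).
have fE L w : w \in words L -> f (string_of w) = Q * t w.
  move=> hw; rewrite /f (summand_string hq0 hz off_x off_y (string_len_of hw)).
  by rewrite (string_ofK hw).
apply: (has_sum_words r0 r1 C0) => [L|L a ha].
  have -> : \sum_(w <- words L) f (string_of w) - sigma / alpha =
      Q / alpha * (alpha * \sum_(w <- words L) t w - sigma * q^-1 ^+ (4 * size ys * size xs)).
    rewrite (eq_big_seq (fun w => Q * t w)) => [|w hw]; last exact: fE hw.
    rewrite -mulr_sumr mulrBr; congr (_ - _).
      by rewrite mulrA divfK.
    have cancel (a b d : R[i]) : b != 0 -> d != 0 -> a / b = d / b * (a / d).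
      by move=> b0 d0; field; rewrite b0 d0.
    by rewrite sx sy exprVn; apply: cancel => //; rewrite expf_neq0.
  rewrite normrM /C mulrC mulrDr mulrDl; apply: ler_wpDr.
    by rewrite !mulr_ge0 // exprn_ge0.
  by rewrite [X in _ <= X]mulrAC ler_wpM2r.
rewrite (eq_big_seq (fun w => `|Q| * `|t (rcons w a)|)) => [|w hw]; last first.
  rewrite -normrM; congr (`|_|); apply: (fE L.+1); move: hw; rewrite !mem_words size_rcons.
  by rewrite eqSS all_rcons => /andP[-> ->]; case/andP: ha => _ ->.
rewrite -mulr_sumr /C mulrDr mulrDl; apply: ler_wpDl.
  by rewrite !mulr_ge0 // exprn_ge0.
by rewrite [c * _]mulrC -mulrA ler_wpM2l // tail.
Qed.
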